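(* Let $\mu$ be an admissible measure on $\mathbb{R}^d$. There exists an admissible measure on $\mathbb{R}^d$, different from $\mu$, with the same power moments as $\mu$ if and only if there exist $\xi \in \mathbb{R}^d \setminus \{0\}$ and $\epsilon \in \{0, -\pi/2\}$ such that $$ \sup_{p(x) \leq \cos( x \cdot \xi + \epsilon)\ \forall x\in\mathbb{R}^d} \int p \, d\mu \;<\; \inf_{q(x) \geq \cos( x \cdot \xi + \epsilon)\ \forall x\in\mathbb{R}^d} \int q \, d\mu,$$ where $p, q$ range over $\mathbb{R}[x_1, \ldots, x_d]$. Moreover, for fixed $\epsilon$, the set of $\xi \in \mathbb{R}^d\setminus\{0\}$ satisfying this strict inequality is open.
   Context: An admissible measure on a closed set $X \subseteq \mathbb{R}^d$ is a positive Radon measure $\mu$ supported on $X$ such that $\int_X |p|\,d\mu<\infty$ for every polynomial $p \in \mathbb{R}[x_1,\dots,x_d]$. Two admissible measures are moment equivalent if they give the same integral to every polynomial. $x\cdot\xi=\sum_j x_j\xi_j$ is the standard inner product. *)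

(* Defs.v *)
(* R^d is modelled as [n.-tuple R] with its product
   (= Borel) sigma-algebra; polynomials are multinomials' [mpoly n R]. *)
From HB Require Import structures.
From mathcomp Require Import all_boot all_order all_algebra.
From mathcomp Require Import all_classical all_reals all_analysis.
From mathcomp Require mpoly.
Set Implicit Arguments.
Unset Strict Implicit.
Unset Printing Implicit Defensive.
Import Order.TTheory GRing.Theory Num.Theory.
Import numFieldNormedType.Exports.
Local Open Scope classical_set_scope.
Local Open Scope ring_scope.

Definition peval (R : realType) (n : nat) (p : mpoly.mpoly n R)
  (x : n.-tuple R) : R := mpoly.meval (fun i => tnth x i) p.

(* admissible measure on R^n: every polynomial is integrable
   (a positive Borel measure on R^n integrating all polynomials is finite,
   hence Radon) *)
Definition admissible (R : realType) (n : nat)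
  (mu : {measure set (n.-tuple R) -> \bar R}) : Prop :=
  forall p : mpoly.mpoly n R, mu.-integrable setT (fun x => (peval p x)%:E).

Definition moment_equiv (R : realType) (n : nat)
  (mu nu : {measure set (n.-tuple R) -> \bar R}) : Prop :=
  forall p : mpoly.mpoly n R,
    (\int[mu]_x (peval p x)%:E = \int[nu]_x (peval p x)%:E)%E.

Definition dotp (R : realType) (n : nat) (x : n.-tuple R) (xi : 'rV[R]_n) : R :=
  \sum_(i < n) tnth x i * xi ord0 i.

Definition lower_bound_cos (R : realType) (n : nat)
  (mu : {measure set (n.-tuple R) -> \bar R}) (xi : 'rV[R]_n) (eps : R) : \bar R :=
  ereal_sup [set (\int[mu]_x (peval p x)%:E)%E | p in
     [set p : mpoly.mpoly n R | forall x, peval p x <= cos (dotp x xi + eps)]].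

Definition upper_bound_cos (R : realType) (n : nat)
  (mu : {measure set (n.-tuple R) -> \bar R}) (xi : 'rV[R]_n) (eps : R) : \bar R :=
  ereal_inf [set (\int[mu]_x (peval q x)%:E)%E | q in
     [set q : mpoly.mpoly n R | forall x, cos (dotp x xi + eps) <= peval q x]].

Definition measure_differs (R : realType) (n : nat)
  (mu nu : {measure set (n.-tuple R) -> \bar R}) : Prop :=
  exists A : set (n.-tuple R), measurable A /\ nu A <> mu A.

(* Main.v *)
(* If nu differs from mu but has the same moments, then by uniqueness of the
   Fourier transform the integrals of some cos (x.xi + eps) against mu and nu
   differ, and both lie between the two bounds. Uniqueness holds because the
   indicator of a lower orthant is an iterated bounded pointwise limit of
   trigonometric polynomials.

   Conversely, U g := inf {int q dmu | q >= g} is sublinear on the functions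
   bounded by a polynomial, and -U (-f), U f are the two bounds for f the
   cosine. If they differ, Hahn-Banach gives a linear L <= U with L f different
   from int f dmu; L is positive and agrees with mu on polynomials. The finitely
   additive content A |-> L 1_A is tight, hence sigma-additive on the algebra of
   sets approximated from inside by compact sets and from outside by open sets.
   It extends to a measure whose integral agrees with L on polynomials and on f.

   U (cos (x.xi + eps)) is Lipschitz in xi, which gives openness. *)
Require Import Defs.
From HB Require Import structures.
From mathcomp Require Import all_boot all_order all_algebra.
From mathcomp Require Import all_classical all_reals all_analysis.
From mathcomp Require mpoly.
From mathcomp Require Import measurable_realfun.
From mathcomp Require Import ring lra.
Import (canonicals) mpoly.
Import Order.TTheory GRing.Theory Num.Theory.
Import numFieldNormedType.Exports.
Local Open Scope classical_set_scope.
Local Open Scope ring_scope.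

(** * Sublinear functionals *)

Section sublinear.
Context {R : realType} {V : lmodType R} (E : set V).
Hypotheses (E0 : E 0) (ED : forall x y, E x -> E y -> E (x + y)).
Hypothesis EZ : forall (a : R) x, E x -> E (a *: x).

Definition sublinear_on (p : V -> R) :=
  (forall x y, E x -> E y -> p (x + y) <= p x + p y) /\
  (forall (a : R) x, 0 <= a -> E x -> p (a *: x) <= a * p x).

Lemma sublinear_on0 p : sublinear_on p -> p 0 = 0.
Proof.
move=> [pD pZ]; apply/eqP; rewrite eq_le; apply/andP; split.
  by have := pZ 0 0 (lexx _) E0; rewrite scale0r mul0r.
by have := pD 0 0 E0 E0; rewrite addr0; lra.
Qed.

Let EN x : E x -> E (- x).
Proof. by move=> Ex; rewrite -scaleN1r; exact: EZ. Qed.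

Lemma sublinear_on_opp p x : sublinear_on p -> E x -> - p (- x) <= p x.
Proof.
move=> sp Ex; have := sp.1 x (- x) Ex (EN x Ex).
by rewrite subrr (sublinear_on0 p sp); lra.
Qed.

(** For [a > 0] the reverse inequality is the scaling inequality for [a^-1] at [a *: x]. *)
Lemma sublinear_on_scale p (a : R) x : sublinear_on p -> 0 <= a -> E x ->
  p (a *: x) = a * p x.
Proof.
move=> sp; rewrite le_eqVlt => /predU1P[<- _|a0 Ex].
  by rewrite scale0r mul0r sublinear_on0.
apply/eqP; rewrite eq_le (sp.2 a x (ltW a0) Ex)/=.
have := sp.2 a^-1 (a *: x) _ (EZ a x Ex).
rewrite invr_ge0 (ltW a0) scalerA mulVf ?gt_eqF// scale1r => /(_ isT).
by rewrite mulrC ler_pdivlMr// mulrC.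
Qed.

(** The infimum of [p (x + t *: y) - t * c] over the shifts [t] in [D] stays sublinear because
    shifts add and scale within [D]. Nonnegative shifts with [c = p y] serve to exploit minimality,
    all real shifts to prescribe the value [c] at [y]. *)
Lemma sublinear_on_inf (p : V -> R) (D : set R) y (c : R) :
  sublinear_on p -> E y -> D 0 -> (forall s t, D s -> D t -> D (s + t)) ->
  (forall a t, 0 <= a -> D t -> D (a * t)) ->
  (forall t, D t -> t * c <= p (t *: y)) ->
  exists q, [/\ sublinear_on q, (forall x, E x -> q x <= p x) &
    forall x t, E x -> D t -> q x <= p (x + t *: y) - t * c].
Proof.
move=> sp Ey D0 DD DZ Dc.
pose q x := inf [set p (x + t *: y) - t * c | t in D].
(* The hypothesis on [c] enters here: it bounds the set below, so that [inf] is a true infimum and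
   not its default value. *)
have qlb x : E x -> lbound [set p (x + t *: y) - t * c | t in D] (- p (- x)).
  move=> Ex _ [t Dt <-].
  have := sp.1 (x + t *: y) (- x) (ED _ _ Ex (EZ t y Ey)) (EN x Ex).
  by rewrite addrAC subrr add0r; have := Dc t Dt; lra.
have qle x t : E x -> D t -> q x <= p (x + t *: y) - t * c.
  by move=> Ex Dt; apply: ge_inf; [exists (- p (- x)); exact: qlb|exists t].
have geq_ x u : E x -> (forall t, D t -> u <= p (x + t *: y) - t * c) -> u <= q x.
  move=> Ex ut; apply: lb_le_inf; last by move=> _ [t Dt <-]; exact: ut.
  by exists (p (x + 0 *: y) - 0 * c), 0.
exists q; split; [split| |exact: qle].
- move=> x x' Ex Ex'.
  have Exx' := ED x x' Ex Ex'.
  (* The infimum in [q x'] is removed first, then the one in [q x]; the two shifts add up to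
     [s + t]. *)
  suff : q (x + x') - q x <= q x' by lra.
  apply: (geq_ _ _) => // t Dt.
  suff : q (x + x') - (p (x' + t *: y) - t * c) <= q x by lra.
  apply: (geq_ _ _) => // s Ds.
  have := qle (x + x') (s + t) Exx' (DD s t Ds Dt).
  have := sp.1 (x + s *: y) (x' + t *: y) (ED _ _ Ex (EZ s y Ey)) (ED _ _ Ex' (EZ t y Ey)).
  by rewrite addrACA -scalerDl mulrDl; lra.
- move=> a x; rewrite le_eqVlt => /predU1P[<- Ex|a0 Ex].
    rewrite scale0r mul0r; have := qle 0 0 E0 D0.
    rewrite scale0r addr0 mul0r subr0 (sublinear_on0 p sp). by [].
  rewrite mulrC -ler_pdivrMr//; apply: (geq_ _ _) => // t Dt; rewrite ler_pdivrMr//.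
  have := qle (a *: x) (a * t) (EZ a x Ex) (DZ a t (ltW a0) Dt).
  rewrite -scalerA -scalerDr (@sublinear_on_scale p a) ?(ltW a0)//.
    by move=> h; apply: le_trans h _; rewrite le_eqVlt; apply/orP; left; apply/eqP; ring.
  by apply: ED => //; exact: EZ.
- by move=> x Ex; have := qle x 0 Ex D0; rewrite scale0r addr0 mul0r subr0.
Qed.

(* A minimal sublinear functional is linear: by [sublinear_on_inf], lowering it
   along a direction [y] shows [p (- y) = - p y]. *)
Lemma sublinear_on_minorant (S : V -> R) : sublinear_on S ->
  exists L : V -> R, [/\ (forall x, E x -> L x <= S x),
    (forall x y, E x -> E y -> L (x + y) = L x + L y) &
    (forall (a : R) x, E x -> L (a *: x) = a * L x)].
Proof.
move=> sS.
pose T := {p : V -> R | sublinear_on p /\ forall x, E x -> p x <= S x}.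
(* The order is reversed, so that Zorn's lemma yields a minimal functional. It is only a preorder,
   since values outside [E] are not compared. *)
pose r (p q : T) := `[< forall x, E x -> sval q x <= sval p x >].
have T0 : sublinear_on S /\ forall x, E x -> S x <= S x by [].
have [| | |[p [sp pS]] pmin] := @ZL_preorder T (exist _ S T0) r.
- by move=> t; apply/asboolP.
- move=> p q s /asboolP pq /asboolP qs; apply/asboolP => x Ex.
  exact: le_trans (qs x Ex) (pq x Ex).
- move=> A Atot; have [[s0 As0]|A0] := pselect (exists s, A s); last first.
    by exists (exist _ S T0) => s As; exfalso; apply: A0; exists s.
  (* A nonempty chain is bounded by its pointwise infimum, which is finite on [E] because every
     member is at least [- S (- x)] at [x]. *)
  pose t x := inf [set sval s x | s in A].
  have tle s x : A s -> E x -> t x <= sval s x.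
    move=> As Ex; apply: ge_inf; last by exists s.
    exists (- S (- x)) => _ [u Au <-]; case: u Au => u [su uS] /= _.
    apply: le_trans (sublinear_on_opp u x su Ex).
    by rewrite lerN2; apply: uS; exact: EN.
  have let_ x u : (forall s, A s -> u <= sval s x) -> u <= t x.
    move=> us; apply: lb_le_inf; first by exists (sval s0 x), s0.
    by move=> _ [s As <-]; exact: us.
  have st : sublinear_on t.
    split.
      move=> x y Ex Ey; suff : t (x + y) - t x <= t y by lra.
      apply: (let_ _ _) => s As; suff : t (x + y) - sval s y <= t x by lra.
      apply: (let_ _ _) => s' As'.
      (* Subadditivity needs one member of the chain that is good for [x] and [y] at once: the
         smaller of [s] and [s']. *)
      have [/asboolP ss|/asboolP ss] := Atot s s' As As'.
        have := tle s' (x + y) As' (ED _ _ Ex Ey).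
        have := (svalP s').1.1 x y Ex Ey.
        by have := ss y Ey; lra.
      have := tle s (x + y) As (ED _ _ Ex Ey).
      have := (svalP s).1.1 x y Ex Ey.
      by have := ss x Ex; lra.
    move=> a x; rewrite le_eqVlt => /predU1P[<- Ex|a0 Ex].
      rewrite scale0r mul0r; have := tle s0 0 As0 E0.
      by rewrite (sublinear_on0 _ (svalP s0).1).
    rewrite mulrC -ler_pdivrMr//; apply: (let_ _ _) => s As; rewrite ler_pdivrMr//.
    apply: le_trans (tle s _ As (EZ a x Ex)) _.
    by rewrite mulrC; apply: (svalP s).1.2 => //; exact: ltW.
  have tT : sublinear_on t /\ forall x, E x -> t x <= S x.
    split=> // x Ex; apply: le_trans (tle s0 x As0 Ex) _; exact: (svalP s0).2.
  by exists (exist _ t tT) => s As; apply/asboolP => x Ex /=; exact: tle.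
have pN y : E y -> p (- y) = - p y.
  move=> Ey.
  have [| | | |q [sq qp qt]] := @sublinear_on_inf p [set t | 0 <= t] y (p y) sp Ey.
  - exact: lexx.
  - by move=> s t; exact: addr_ge0.
  - by move=> a t; exact: mulr_ge0.
  - by move=> t /= t0; rewrite sublinear_on_scale.
  have qT : sublinear_on q /\ forall x, E x -> q x <= S x.
    by split=> // x Ex; apply: le_trans (qp x Ex) (pS x Ex).
  have /asboolP/(_ (- y) (EN y Ey))/= pq : r (exist _ q qT) (exist _ p (conj sp pS)).
    by apply: pmin; apply/asboolP.
  apply/eqP; rewrite eq_le; apply/andP; split; last first.
    by have := sublinear_on_opp p y sp Ey; lra.
  (* With shift 1 at [- y] the bound reads [q (- y) <= p 0 - p y], while minimality gives
     [p (- y) <= q (- y)]. *)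
  have := qt (- y) 1 (EN y Ey) ler01.
  by rewrite scale1r addNr sublinear_on0// mul1r; lra.
exists p; split => //.
- move=> x y Ex Ey; apply/eqP; rewrite eq_le sp.1//=.
  have := sp.1 (- x) (- y) (EN x Ex) (EN y Ey).
  by rewrite -opprD !pN//; [lra|exact: ED].
- move=> a x Ex; have [a0|a0] := leP 0 a; first by rewrite sublinear_on_scale.
  rewrite -(opprK a) scaleNr pN; last exact: EZ.
  by rewrite sublinear_on_scale// ?oppr_ge0 ?(ltW a0)//; lra.
Qed.

(** First lower [S] along all real multiples of [f]. Shift -1 at [f] gives [q f <= c] and shift 1 at
    [- f] gives [q (- f) <= - c], so every linear minorant of [q] takes the value [c] at [f]. *)
Lemma sublinear_on_extension (S : V -> R) f (c : R) : sublinear_on S -> E f ->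
  - S (- f) <= c <= S f ->
  exists L : V -> R, [/\ (forall x, E x -> L x <= S x),
    (forall x y, E x -> E y -> L (x + y) = L x + L y),
    (forall (a : R) x, E x -> L (a *: x) = a * L x) & L f = c].
Proof.
move=> sS Ef /andP[Sc cS].
have [| | | |q [sq qS qt]] := @sublinear_on_inf S setT f c sS Ef => //.
  move=> t _; have [t0|t0] := leP 0 t.
    by rewrite sublinear_on_scale//; exact: ler_wpM2l.
  rewrite -(opprK t) scaleNr -scalerN sublinear_on_scale ?oppr_ge0 ?(ltW t0)//.
    by rewrite mulNr -mulrN; apply: ler_wpM2l; [rewrite oppr_ge0 ltW|lra].
  exact: EN.
have [L [Lq LD LZ]] := @sublinear_on_minorant q sq.
exists L; split => //; first by move=> x Ex; exact: le_trans (Lq x Ex) (qS x Ex).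
have LN : L (- f) = - L f by rewrite -scaleN1r LZ// mulN1r.
apply/eqP; rewrite eq_le; apply/andP; split.
  have := qt f (-1) Ef I; rewrite scaleN1r subrr sublinear_on0//.
  by have := Lq f Ef; lra.
have := qt (- f) 1 (EN f Ef) I; rewrite scale1r addNr sublinear_on0//.
by have := Lq _ (EN f Ef); rewrite LN; lra.
Qed.

End sublinear.

(** * Measures from tight finitely additive contents *)

(** A monotone function has countably many discontinuities, hence a Lebesgue-null set of them,
    whereas the interval has positive length. *)
Lemma nondecreasing_continuity_point {R : realType} (F : R -> R) (a b : R) :
  {homo F : x y / x <= y} -> a < b ->
  exists2 t, a < t < b & forall e, 0 < e ->
    exists s1 s2, [/\ s1 < t, t < s2 & F s2 - F s1 < e].
Proof.
move=> ndF ab.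
have ndF' : {in `[a, b] &, nondecreasing_fun F} by move=> x y _ _; exact: ndF.
have cD := countable_lebesgue_measure0 (discontinuity_countable ndF').
have [t /andP[/= tab tD]] : exists t, (t \in `]a, b[) && ~~ `[< discontinuity F t >].
  apply: contrapT => /forallNP h.
  have sub : `]a, b[%classic `<=` [set x | x \in (`]a, b[) /\ discontinuity F x].
    move=> x /= xab; split=> //; have /negP := h x.
    by rewrite xab/= negbK => /asboolP.
  have : (lebesgue_measure `]a, b[%classic = 0 :> \bar R)%E.
    apply/eqP; rewrite eq_le measure_ge0 andbT -cD.
    apply: le_outer_measure => //.
  rewrite lebesgue_measure_itv/= lte_fin ab => /eqP.
  by rewrite -EFinB eqe subr_eq0 gt_eqF.
exists t; first by move: tab; rewrite in_itv.
move=> e e0.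
have cr : cvg (F x @[x --> t^'+]).
  apply: nondecreasing_at_right_is_cvgr; near=> z.
    by move=> x y _ _; exact: ndF.
  by exists (F t) => _ [x /= + <-]; rewrite in_itv/= => /andP[/ltW tx _]; exact: ndF.
have cl : cvg (F x @[x --> t^'-]).
  apply: nondecreasing_at_left_is_cvgr; near=> z.
    by move=> x y _ _; exact: ndF.
  by exists (F t) => _ [x /= + <-]; rewrite in_itv/= => /andP[_ /ltW xt]; exact: ndF.
(* Outside the discontinuity set the one-sided limits agree; [s1] and [s2] are then taken where [F]
   is within [e / 2] of the common limit. *)
have lr : lim (F x @[x --> t^'-]) = lim (F x @[x --> t^'+]).
  by apply/eqP/negPn/negP => h; move/asboolP : tD; apply.
have e2 : 0 < e / 2 by rewrite divr_gt0.
have /(_ _ e2)[s1 /andP[s1t Fs1]] : forall e, 0 < e ->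
    exists s, (s < t) && (`|lim (F x @[x --> t^'+]) - F s| < e).
  move=> d d0; move: cl => /cvgrPdist_lt/(_ d d0); rewrite lr => cl.
  near t^'- => s; exists s; apply/andP; split => //.
  by near: s.
have /(_ _ e2)[s2 /andP[ts2 Fs2]] : forall e, 0 < e ->
    exists s, (t < s) && (`|lim (F x @[x --> t^'+]) - F s| < e).
  move=> d d0; move: cr => /cvgrPdist_lt/(_ d d0) cr.
  near t^'+ => s; exists s; apply/andP; split => //.
  by near: s.
exists s1, s2; split => //.
by move: Fs1 Fs2; rewrite !ltr_norml => /andP[? ?] /andP[? ?]; lra.
Unshelve. all: by end_near. Qed.

(** The content is real-valued and defined on every subset, as a positive functional evaluated at
    indicators is; regularity is imposed on sets afterwards. *)
Record tight_content (R : realType) (T : ptopologicalType) := TightContent {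
  tc_fun :> set T -> R;
  tc_ge0 : forall A, 0 <= tc_fun A;
  tcU : forall A B, A `&` B = set0 -> tc_fun (A `|` B) = tc_fun A + tc_fun B;
  tc_tight : forall e, 0 < e ->
    exists K, [/\ compact K, closed K & tc_fun (~` K) < e] }.

(** An alias of [T] that remembers [m], so that the algebra of sets attached to it can depend on
    [m]. *)
Definition regular_type {R : realType} {T : ptopologicalType}
  (m : tight_content R T) : Type := T.

Section tight_content_theory.
Context {R : realType} {T : ptopologicalType} (m : tight_content R T).

Lemma tc0 : m set0 = 0.
Proof. by have := @tcU _ _ m set0 set0 (setI0 _); rewrite setU0; lra. Qed.

Lemma tcD A B : A `<=` B -> m B = m A + m (B `\` A).
Proof. by move=> AB; rewrite -tcU ?setDIK// setDUK. Qed.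

Lemma le_tc A B : A `<=` B -> m A <= m B.
Proof. by move=> /tcD ->; rewrite lerDl tc_ge0. Qed.

Lemma tcU_le A B : m (A `|` B) <= m A + m B.
Proof.
rewrite (_ : A `|` B = A `|` (B `\` A)); last by rewrite setUDr setDv setD0.
by rewrite tcU ?setDIK// lerD2l le_tc//; exact: subDsetl.
Qed.

Lemma tc_bigU_le (F : nat -> set T) N :
  m (\big[setU/set0]_(i < N) F i) <= \sum_(i < N) m (F i).
Proof.
elim: N => [|N ih]; first by rewrite !big_ord0 tc0.
by rewrite !big_ord_recr/= (le_trans (tcU_le _ _))// lerD2r.
Qed.

(** Closedness is recorded next to compactness because [T] is not assumed to be Hausdorff. *)
Definition regular_set (A : set T) := forall e, 0 < e -> exists K U,
  [/\ compact K, closed K, open U, K `<=` A & A `<=` U /\ m (U `\` K) < e].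

Lemma regular_set0 : regular_set set0.
Proof.
move=> e e0; exists set0, set0; split => //.
- exact: compact0.
- exact: closed0.
- exact: open0.
- by split => //; rewrite setD0 tc0.
Qed.

Lemma regular_setU A B : regular_set A -> regular_set B -> regular_set (A `|` B).
Proof.
move=> rA rB e e0; have e2 : 0 < e / 2 by rewrite divr_gt0.
have [K [U [cK clK oU KA [AU mA]]]] := rA _ e2.
have [K' [U' [cK' clK' oU' KB [BU mB]]]] := rB _ e2.
exists (K `|` K'), (U `|` U'); split => //.
- exact: compactU.
- exact: closedU.
- exact: openU.
- exact: setUSS.
- split; first exact: setUSS.
  apply: (@le_lt_trans _ _ (m ((U `\` K) `|` (U' `\` K')))).
    by apply: le_tc => x [[Ux|Ux] /not_orP[Kx Kx']]; [left|right].
  by have := tcU_le (U `\` K) (U' `\` K'); lra.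
Qed.

(** The complement of the outer open set is closed but may fail to be compact; intersecting it with
    a compact set from tightness costs only [e / 2]. *)
Lemma regular_setC A : regular_set A -> regular_set (~` A).
Proof.
move=> rA e e0; have e2 : 0 < e / 2 by rewrite divr_gt0.
have [K [U [cK clK oU KA [AU mA]]]] := rA _ e2.
have [C [cC clC mC]] := @tc_tight _ _ m _ e2.
exists (C `&` ~` U), (~` K); split.
- by apply: compact_closedI => //; exact: open_closedC.
- by apply: closedI => //; exact: open_closedC.
- exact: closed_openC.
- by move=> x [_ Ux] /AU.
- split; first exact: subsetC.
  apply: (@le_lt_trans _ _ (m ((U `\` K) `|` ~` C))); last first.
    by have := tcU_le (U `\` K) (~` C); lra.
  apply: le_tc => x [Kx] /not_andP[Cx|/contrapT Ux]; first by right.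
  by left.
Qed.

HB.instance Definition _ := Pointed.on (regular_type m).
HB.instance Definition _ := @isAlgebraOfSets.Build default_measure_display
  (regular_type m) regular_set regular_set0 regular_setU regular_setC.

Definition regular_content (A : set (regular_type m)) : \bar R := (m A)%:E.

Let regular_content_ge0 A : (0 <= regular_content A)%E.
Proof. by rewrite lee_fin tc_ge0. Qed.

Let regular_content_additive : measure_function.semi_additive regular_content.
Proof.
move=> F n mF tF _; rewrite /regular_content sumEFin; congr EFin.
elim: n => [|n ih]; first by rewrite !big_ord0 tc0.
rewrite !big_ord_recr/= tcU ?ih//.
apply/seteqP; split => // x [] ; rewrite -bigcup_mkord => -[i /= ni Fi] Fn.
have := tF i n I I; move/trivIsetP : tF => /(_ i n I I).
by rewrite (ltn_eqF ni) => /(_ isT)/seteqP[+ _] _; apply; split; eauto.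
Qed.

HB.instance Definition _ := isContent.Build _ _ _ regular_content
  regular_content_ge0 regular_content_additive.

(* Alexandroff's argument: inner approximation by compact sets and outer
   approximation by open sets reduce a countable cover to a finite one. *)
Let regular_content_sigma_subadditive :
  measurable_subset_sigma_subadditive regular_content.
Proof.
move=> A F mF mA AF; apply/lee_addgt0Pr => e e0.
have e2 : 0 < e / 2 by rewrite divr_gt0.
have [K [U0 [cK _ _ KA [AU0 mU0]]]] := mA _ e2.
have mAK : m A <= m K + e / 2.
  rewrite (tcD _ _ KA) lerD2l; apply: le_trans (ltW mU0); apply: le_tc.
  exact: setSD.
(* The errors [(e / 2) / 2 ^ i.+1] sum to [e / 2]; the other half of [e] pays for replacing [A] by
   the compact set [K]. *)
have /choice[U UP] : forall i, exists U, [/\ open U, F i `<=` U &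
    m U <= m (F i) + (e / 2) / (2 ^ i.+1)%:R].
  move=> i; have ei : 0 < (e / 2) / (2 ^ i.+1)%:R.
    by rewrite divr_gt0// ltr0n expn_gt0.
  have [K' [U [_ _ oU KF [FU mU]]]] := mF i _ ei.
  exists U; split => //; rewrite (tcD _ _ FU) lerD2l; apply: le_trans (ltW mU).
  by apply: le_tc; exact: setDS.
have : cover_compact K by rewrite -compact_cover.
move=> /(_ nat setT U)[| |D _ KD].
- by move=> i _; have [] := UP i.
- by move=> x /KA/AF[i _ Fix]; exists i => //; have [_ + _] := UP i; apply.
pose N := (\max_(i <- finmap.enum_fset D) i).+1.
have KN : K `<=` \big[setU/set0]_(i < N) U i.
  move=> x /KD[i /= iD Uix]; rewrite -bigcup_mkord; exists i => //=.
  by rewrite ltnS; apply: (@leq_bigmax_seq _ _ predT id).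
apply: (@le_trans _ _ (\sum_(i <oo) (regular_content (F i) +
    ((e / 2) / (2 ^ i.+1)%:R)%:E) + (e / 2)%:E)%E); last first.
  rewrite [in leRHS](splitr e) EFinD addeA leeD2r//.
  by apply: epsilon_trick => //; exact: ltW.
apply: (@le_trans _ _ ((m K)%:E + (e / 2)%:E)%E); first by rewrite -EFinD lee_fin.
rewrite leeD2r//.
apply: (@le_trans _ _ (\sum_(0 <= i < N) (regular_content (F i) +
    ((e / 2) / (2 ^ i.+1)%:R)%:E))%E); last first.
  apply: nneseries_lim_ge => i _ _; apply: adde_ge0 => //.
  by rewrite lee_fin divr_ge0// ltW.
rewrite /regular_content big_mkord; under eq_bigr do rewrite -EFinD.
rewrite sumEFin lee_fin (le_trans (le_tc _ _ KN))// (le_trans (tc_bigU_le _ _))//.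
by apply: ler_sum => i _; have [] := UP i.
Qed.

HB.instance Definition _ := @Content_SigmaSubAdditive_isMeasure.Build _ _ _
  regular_content regular_content_sigma_subadditive.

End tight_content_theory.

(** * Continuous functions and the extended measure *)

Section tight_content_measure.
Context {R : realType} {T : ptopologicalType} (m : tight_content R T).

(** At a continuity point [t] of [t |-> m {g <= t}] the sublevel set is squeezed between the closed
    set [{g <= s1}], cut down to a compact set by tightness, and the open set [{g < s2}]. *)
Lemma regular_sublevel (g : T -> R) a b : continuous g -> a < b ->
  exists2 t, a < t < b & regular_set m [set x | g x <= t].
Proof.
move=> cg ab; pose F t := m [set x | g x <= t].
have ndF : {homo F : s t / s <= t}.
  by move=> s t st; apply: le_tc => x /= /le_trans; apply.
have [t tab Ft] := nondecreasing_continuity_point _ _ _ ndF ab.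
exists t => // e e0; have e2 : 0 < e / 2 by rewrite divr_gt0.
have [s1 [s2 [s1t ts2 Fs]]] := Ft _ e2.
have [C [cC clC mC]] := @tc_tight _ _ m _ e2.
have clg s : closed [set x | g x <= s].
  by move/continuous_closedP : cg => /(_ [set y | y <= s]); apply; exact: closed_le.
exists (C `&` [set x | g x <= s1]), [set x | g x < s2]; split.
- exact: compact_closedI.
- exact: closedI.
- by move/continuousP : cg => /(_ [set y | y < s2]); apply; exact: open_lt.
- by move=> x [_ /= /le_trans]; apply; exact: ltW.
- split; first by move=> x /= /le_lt_trans; apply.
  have s12 : [set x | g x <= s1] `<=` [set x | g x <= s2].
    by move=> x /= /le_trans; apply; apply/ltW/(lt_trans s1t).
  apply: (@le_lt_trans _ _
    (m (([set x | g x <= s2] `\` [set x | g x <= s1]) `|` ~` C))).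
    apply: le_tc => x [/= /ltW gx] /not_andP[Cx|gx1]; first by right.
    by left.
  have := tcU_le m ([set x | g x <= s2] `\` [set x | g x <= s1]) (~` C).
  by have := tcD m _ _ s12; rewrite /F in Fs; lra.
Qed.

(** Stated as an induction principle over staircases, so that a property such as equality of two
    integrals can be carried along. Each step cuts [h] at a regular level [t] between [e / 2] and
    [e]: it adds [t] on [{h > t}] and continues with the positive part of [h - t]. *)
Lemma continuous_staircase (P : (T -> R) -> Prop) :
  P (fun=> 0) ->
  (forall s t A, 0 <= t -> P s -> regular_set m A ->
    P (fun x => s x + t * \1_A x)) ->
  forall (g : T -> R) B, continuous g -> (forall x, 0 <= g x <= B) ->
  forall e, 0 < e -> exists2 s, P s & forall x, 0 <= g x - s x <= e.
Proof.
move=> P0 PD g B cg gB e e0.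
(* Height is counted in units of [e / 2], and each cut removes more than one unit. *)
suff H N : forall h : T -> R, continuous h ->
    (forall x, 0 <= h x <= N%:R * (e / 2)) ->
    exists2 s, P s & forall x, 0 <= s x <= h x /\ h x <= s x + e.
  have [|s Ps sg] := H (Num.truncn (B / (e / 2))).+1 g cg.
    move=> x; have /andP[-> gxB] := gB x; rewrite (le_trans gxB)//=.
    rewrite -ler_pdivrMr ?divr_gt0//; apply/ltW/truncnS_gt.
  exists s => // x; have [/andP[_ ?] ?] := sg x.
  by apply/andP; split; lra.
elim: N => [|N ih] h ch hN.
  exists (fun=> 0) => // x; have := hN x; rewrite mul0r => /andP[? ?].
  by split; [rewrite lexx|rewrite add0r; lra].
have [t /andP[t1 t2] rt] : exists2 t, e / 2 < t < e & regular_set m [set x | h x <= t].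
  by apply: regular_sublevel => //; lra.
have [|x|s Ps sh] := ih (fun x => Num.max (h x - t) 0).
- move=> x; apply: (@continuous_max _ _ (fun x => h x - t) (fun=> 0)); last exact: cvg_cst.
  by apply: cvgB; [exact: ch|exact: cvg_cst].
- rewrite le_max lexx orbT/= ge_max; have := hN x; rewrite -natr1 mulrDl mul1r.
  move=> /andP[? ?]; apply/andP; split; first lra.
  by rewrite mulr_ge0// ltW// divr_gt0.
exists (fun x => s x + t * \1_(~` [set x | h x <= t]) x).
  by apply: PD => //; [lra|exact: regular_setC].
move=> x; have [] := sh x; rewrite indicE.
have [ht|ht] := leP (h x) t.
  rewrite memNset ?mulr0 ?addr0; last by move=> /=; apply.
  rewrite max_r; last by lra.
  have /andP[? _] := hN x.
  by move=> /andP[? ?] ?; split; [apply/andP; split|]; lra.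
rewrite mem_set/= ?mulr1; last by apply/negP; rewrite -ltNge.
rewrite max_l; last by lra.
by move=> /andP[? ?] ?; split; [apply/andP; split|]; lra.
Qed.

Local Notation gT := (g_sigma_algebraType (@measurable _ (regular_type m))).

Definition tc_measure : {measure set gT -> \bar R} :=
  measure_extension (regular_content m).

Lemma tc_measureE (A : set T) : regular_set m A -> tc_measure A = (m A)%:E.
Proof. by move=> rA; rewrite /= /measure_extension measurable_mu_extE. Qed.

Lemma measurable_regular (A : set T) : regular_set m A -> measurable (A : set gT).
Proof. by move=> rA; exact: sub_sigma_algebra. Qed.

(** The sigma-algebra is generated by the regular sets, so [{g < a}] is written as a countable union
    of regular sublevel sets with levels tending to [a] from below. *)
Lemma continuous_measurable_tc (g : T -> R) : continuous g ->
  measurable_fun setT (g : gT -> R).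
Proof.
move=> cg; apply: (measurability _ (RGenInftyO.measurableE R)).
move=> _ [_ [a ->] <-]; rewrite setTI.
have /choice[t tP] : forall k : nat, exists t, a - k.+1%:R^-1 < t < a /\
    regular_set m [set x | g x <= t].
  move=> k; have [|t ? ?] := @regular_sublevel g (a - k.+1%:R^-1) a cg; last by exists t.
  by rewrite ltrBlDr ltrDl invr_gt0.
have -> : (g : gT -> R) @^-1` `]-oo, a[ = \bigcup_k [set x | g x <= t k].
  apply/seteqP; split => [x|x [k _ /=]]; last first.
    by rewrite in_itv/= => /le_lt_trans; apply; have [/andP[]] := tP k.
  rewrite /= in_itv/= => gxa.
  have [k ak] : exists k, k.+1%:R^-1 < a - g x.
    exists (Num.truncn (a - g x)^-1).
    by rewrite invf_plt ?posrE ?subr_gt0// truncnS_gt.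
  exists k => //=; have [/andP[+ _] _] := tP k; move: ak; set u := _^-1; lra.
by apply: bigcupT_measurable => k; apply: measurable_regular; have [] := tP k.
Qed.

End tight_content_measure.

(** * Uniqueness of the Fourier transform *)

Section bounded_eq_integral.
Context {R : realType} {d : measure_display} {T : measurableType d}.
Variables mu nu : {measure set T -> \bar R}.
Hypotheses (muoo : (mu setT < +oo)%E) (nuoo : (nu setT < +oo)%E).

(** Measurability and boundedness are bundled with the equality of integrals to make the class
    stable under linear combinations and bounded pointwise limits. *)
Definition bounded_eq_integral (f : T -> R) :=
  [/\ measurable_fun setT f, exists M, forall x, `|f x| <= M &
    (\int[mu]_x (f x)%:E = \int[nu]_x (f x)%:E)%E].

Let integrable_bounded (m : {measure set T -> \bar R}) (f : T -> R) : (m setT < +oo)%E ->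
  measurable_fun setT f -> (exists M, forall x, `|f x| <= M) ->
  m.-integrable setT (EFin \o f).
Proof.
move=> moo mf [M fM]; apply: measurable_bounded_integrable => //.
exists M; split; first exact: num_real.
by move=> N MN x _; apply: le_trans (fM x) _; exact: ltW.
Qed.

Lemma bounded_eq_integralD f g : bounded_eq_integral f ->
  bounded_eq_integral g -> bounded_eq_integral (fun x => f x + g x).
Proof.
move=> [mf bf ef] [mg bg eg]; split.
- exact: measurable_funD.
- have [[M fM] [N gN]] := (bf, bg); exists (M + N) => x.
  by rewrite (le_trans (ler_normD _ _))// lerD.
- under eq_integral do rewrite EFinD.
  under [in RHS]eq_integral do rewrite EFinD.
  rewrite !integralD//; first by rewrite ef eg.
  all: exact: integrable_bounded.
Qed.

Lemma bounded_eq_integralZ (a : R) f : bounded_eq_integral f ->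
  bounded_eq_integral (fun x => a * f x).
Proof.
move=> [mf bf ef]; split.
- exact: measurable_funM.
- have [M fM] := bf; exists (`|a| * M) => x.
  by rewrite normrM ler_wpM2l.
- under eq_integral do rewrite EFinM.
  under [in RHS]eq_integral do rewrite EFinM.
  rewrite !integralZl//; first by rewrite ef.
  all: exact: integrable_bounded.
Qed.

(** Dominated convergence for both measures, with the constant [M] as dominating function since they
    are finite. *)
Lemma bounded_eq_integral_lim (f_ : nat -> T -> R) (f : T -> R) M :
  (forall k, bounded_eq_integral (f_ k)) -> (forall k x, `|f_ k x| <= M) ->
  (forall x, f_ k x @[k --> \oo] --> f x) -> bounded_eq_integral f.
Proof.
move=> Hf fM ff.
have mf_ k : measurable_fun setT (f_ k) by have [] := Hf k.
have mf : measurable_fun setT f.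
  by apply: (@measurable_fun_cvg _ _ _ _ f_) => // x _; exact: ff.
have bf x : `|f x| <= M.
  have /(cvgr_to_le (F := \oo)) : `|f_ k x| @[k --> \oo] --> `|f x|.
    by apply: cvg_norm; exact: ff.
  by apply; apply: nearW => k; exact: fM.
have M0 : exists N : R, forall x : T, `|cst M x| <= N by exists `|M|.
have cvgI (m : {measure set T -> \bar R}) : (m setT < +oo)%E ->
    (\int[m]_x (f_ k x)%:E)%E @[k --> \oo] --> (\int[m]_x (f x)%:E)%E.
  move=> moo.
  have [|||||_ _] := @dominated_convergence _ T R m setT measurableT
    (fun k x => (f_ k x)%:E) (EFin \o f) (EFin \o cst M); last exact.
  - by move=> k; exact/measurable_EFinP.
  - exact/measurable_EFinP.
  - by apply: aeW => x _; apply: cvg_EFin; [exact: nearW|exact: ff].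
  - by apply: integrable_bounded => //; exact: measurable_cst.
  - by apply: aeW => x k _; rewrite lee_fin.
split => //; first by exists M.
apply: (cvg_unique _ (cvgI mu muoo)) => //.
rewrite (_ : (fun k => _) = (fun k => \int[nu]_x (f_ k x)%:E)%E).
  exact: cvgI.
by apply/funext => k; have [] := Hf k.
Qed.

End bounded_eq_integral.

(** * Polynomial approximation of a step function *)

Section step_approximation.
Context {R : realType}.

(** By Bernoulli's inequality the product is at most [(1 - u) ^+ K * (1 + u) ^+ K], a power of
    [1 - u ^+ 2]. *)
Lemma expr_subr_le (u : R) K : 0 <= u <= 1 -> (1 - u) ^+ K * (1 + K%:R * u) <= 1.
Proof.
move=> /andP[u0 u1].
have bern : 1 + K%:R * u <= (1 + u) ^+ K.
  elim: K => [|K ih]; first by rewrite mul0r addr0 expr0.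
  rewrite exprS -natr1; have : 0 <= K%:R * u * u by rewrite !mulr_ge0.
  have : (1 + u) * (1 + K%:R * u) <= (1 + u) * (1 + u) ^+ K.
    by rewrite ler_wpM2l// addr_ge0.
  by lra.
apply: (@le_trans _ _ ((1 - u) ^+ K * (1 + u) ^+ K)).
  by rewrite ler_wpM2l// exprn_ge0// subr_ge0.
rewrite -exprMn exprn_ile1//; nra.
Qed.

Lemma expr_subr_ge (u : R) K : 0 <= u <= 1 -> 1 - K%:R * u <= (1 - u) ^+ K.
Proof.
move=> /andP[u0 u1]; elim: K => [|K ih]; first by rewrite mul0r subr0 expr0.
rewrite exprS -natr1; have : 0 <= K%:R * u * u by rewrite !mulr_ge0.
have : (1 - u) * (1 - K%:R * u) <= (1 - u) * (1 - u) ^+ K.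
  by rewrite ler_wpM2l// subr_ge0.
by lra.
Qed.

(** The exponent is chosen so that exponent times [s ^+ N] is [N * (2 * s) ^+ N], which tends to 0
    for [s < 1 / 2] and to infinity for [s >= 1 / 2]. The factor [N] settles the case
    [s = 1 / 2]. *)
Definition step_poly (N : nat) (s : R) := (1 - s ^+ N) ^+ (N * 2 ^ N).

Lemma step_poly_itv N s : 0 <= s <= 1 -> 0 <= step_poly N s <= 1.
Proof.
move=> /andP[s0 s1]; have sN0 : 0 <= s ^+ N by rewrite exprn_ge0.
have sN1 : s ^+ N <= 1 by rewrite exprn_ile1.
by rewrite exprn_ge0 ?subr_ge0// exprn_ile1// ?subr_ge0// gerBl.
Qed.

(** With [q] the square root of [r], [N * q ^+ N] is bounded by [(1 - q)^-1], and the remaining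
    factor [q ^+ N] tends to 0. *)
Lemma cvg_natr_expr (r : R) : 0 <= r < 1 -> N%:R * r ^+ N @[N --> \oo] --> (0 : R).
Proof.
move=> /andP[]; rewrite le_eqVlt => /predU1P[<- _|r0 r1].
  rewrite (_ : (fun N => _) = (fun=> 0)); first exact: cvg_cst.
  by apply/funext => -[|N]; rewrite ?mul0r// expr0n mulr0.
pose q := Num.sqrt r.
have q0 : 0 < q by rewrite sqrtr_gt0.
have q1 : q < 1 by rewrite -(sqrtr1 R) ltr_sqrt.
have qq : r = q * q by rewrite -expr2 sqr_sqrtr// ltW.
apply: (@squeeze_cvgr _ _ _ _ (cst 0) (fun N => (1 - q)^-1 * q ^+ N)).
- apply: nearW => N; rewrite mulr_ge0 ?exprn_ge0 ?(ltW r0)//=.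
  rewrite qq exprMn mulrA ler_wpM2r ?exprn_ge0 ?(ltW q0)//.
  rewrite -[leRHS]mul1r ler_pdivlMr ?subr_gt0//.
  have := expr_subr_le (1 - q) N; rewrite subKr gerBl.
  rewrite subr_ge0 (ltW q1) (ltW q0) => /(_ isT).
  have : 0 <= q ^+ N by rewrite exprn_ge0 ?(ltW q0).
  by lra.
- exact: cvg_cst.
- rewrite -[X in _ --> X](mulr0 (1 - q)^-1); apply: cvgMr; apply: cvg_expr.
  by rewrite ger0_norm// ltW.
Qed.

(** Bernoulli's inequality bounds the value below by [1 - N * (2 * s) ^+ N] when [s < 1 / 2];
    otherwise [expr_subr_le] bounds it above by [1 / (N + 1)]. *)
Lemma cvg_step_poly s : 0 <= s <= 1 ->
  step_poly N s @[N --> \oo] --> (if s < 1 / 2 then 1 else 0 : R).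
Proof.
move=> /andP[s0 s1].
have sN N : 0 <= s ^+ N <= 1 by rewrite exprn_ge0// exprn_ile1.
have E N : (N * 2 ^ N)%:R * s ^+ N = N%:R * (2 * s) ^+ N :> R.
  by rewrite natrM natrX exprMn mulrA.
case: ltP => s2.
  apply: (@squeeze_cvgr _ _ _ _ (fun N => 1 - N%:R * (2 * s) ^+ N) (cst 1)).
  - apply: nearW => N; have /andP[_ ->] := step_poly_itv N s (introT andP (conj s0 s1)).
    by rewrite andbT -E expr_subr_ge.
  - rewrite -[X in _ --> X]subr0; apply: cvgB; first exact: cvg_cst.
    apply: cvg_natr_expr; apply/andP; split; lra.
  - exact: cvg_cst.
apply: (@squeeze_cvgr _ _ _ _ (cst 0) (@harmonic R)).
- apply: nearW => N; have /andP[p0 _] := step_poly_itv N s (introT andP (conj s0 s1)).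
  rewrite p0/= /harmonic -[leRHS]mul1r ler_pdivlMr ?ltr0n//.
  apply: le_trans (expr_subr_le (s ^+ N) (N * 2 ^ N) (sN N)).
  rewrite ler_wpM2l// E -natr1 addrC lerD2l ler_peMr//.
  by rewrite exprn_ege1//; lra.
- exact: cvg_cst.
- exact: cvg_harmonic.
Qed.

End step_approximation.

Lemma dotpD {R : realType} {n : nat} (x : n.-tuple R) (xi eta : 'rV[R]_n) :
  dotp x (xi + eta) = dotp x xi + dotp x eta.
Proof.
by rewrite /dotp -big_split/=; apply: eq_bigr => i _; rewrite mxE mulrDr.
Qed.

Lemma dotpN {R : realType} {n : nat} (x : n.-tuple R) (xi : 'rV[R]_n) :
  dotp x (- xi) = - dotp x xi.
Proof.
by rewrite /dotp -sumrN; apply: eq_bigr => i _; rewrite mxE mulrN.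
Qed.

Lemma dotp0 {R : realType} {n : nat} (x : n.-tuple R) :
  dotp x (0 : 'rV[R]_n) = 0.
Proof. by rewrite /dotp big1// => i _; rewrite mxE mulr0. Qed.

Lemma dotp_delta {R : realType} {n : nat} (x : n.-tuple R) (i : 'I_n) (a : R) :
  dotp x (a *: delta_mx ord0 i) = tnth x i * a.
Proof.
rewrite /dotp (bigD1 i)//= big1 ?addr0 => [|j ji]; rewrite !mxE eqxx/=.
  by rewrite eqxx mulr1.
by rewrite (negbTE ji) !mulr0.
Qed.

Lemma measurable_cos_dotp {R : realType} {n : nat} (xi : 'rV[R]_n) (eps : R) :
  measurable_fun setT (fun x : n.-tuple R => cos (dotp x xi + eps)).
Proof.
apply: (measurableT_comp (continuous_measurable_fun (@continuous_cos R))).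
apply: measurable_funD => //; apply: measurable_sum => i.
by apply: measurable_funM => //; exact: measurable_tnth.
Qed.

(** * Lower orthants generate the sigma-algebra *)

Section lower_orthant.
Context {R : realType} {n : nat}.

Definition lower_orthant (a : 'I_n -> R) : set (n.-tuple R) :=
  [set x | forall i, tnth x i < a i].

Lemma measurable_lower_orthant a : measurable (lower_orthant a).
Proof.
rewrite (_ : lower_orthant a =
  \big[setI/setT]_(i < n) ((fun x => tnth x i) @^-1` `]-oo, a i[)).
  apply: bigsetI_measurable => i _; rewrite -[X in measurable X]setTI.
  by apply: measurable_tnth => //; exact: measurable_itv.
rewrite -bigcap_seq; apply/seteqP; split => [x xa i /= _|x xa i].
  by rewrite in_itv/=; exact: xa.
by have := xa i; rewrite /= in_itv/= mem_index_enum; apply.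
Qed.

(** Coordinates outside [I] are released by letting their bound grow. With [I] a singleton this
    produces half-spaces, with [I] empty an exhaustion of the whole space. *)
Lemma bigcup_lower_orthant (a : nat -> 'I_n -> R) (I : set 'I_n) :
  (forall i k, ~ I i -> a k i = k%:R) -> (forall i k l, I i -> a k i = a l i) ->
  \bigcup_k lower_orthant (a k) = [set x | forall i, I i -> tnth x i < a 0%N i].
Proof.
move=> aN aI; apply/seteqP; split => [x [k _ xk] i Ii|x xI].
  by rewrite (aI _ 0%N k)//; exact: xk.
exists (Num.truncn (\sum_(i < n) `|tnth x i|)).+1 => // i.
have [Ii|Ii] := pselect (I i); first by rewrite (aI _ _ 0%N)//; exact: xI.
rewrite aN//; apply: le_lt_trans (truncnS_gt _).
by rewrite (bigD1 i)//= (le_trans (ler_norm _))// lerDl sumr_ge0.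
Qed.

(** The harder inclusion says that the identity is measurable from the generated sigma-algebra. This
    is tested on coordinates, where the half-space [x_i < c] is a countable union of orthants. *)
Lemma measurable_tuple_lower_orthant :
  @measurable _ (n.-tuple R) = <<s range lower_orthant >>.
Proof.
apply/seteqP; split; last first.
  apply: smallest_sub; first exact: sigma_algebra_measurable.
  by move=> _ [a _ <-]; exact: measurable_lower_orthant.
pose GT := g_sigma_algebraType (range lower_orthant).
suff mid : measurable_fun setT (id : GT -> n.-tuple R).
  by move=> A mA; have := mid measurableT A mA; rewrite setTI.
apply/measurable_fun_tnthP => i.
apply: (measurability _ (RGenInftyO.measurableE R)).
move=> _ [_ [c ->] <-]; rewrite setTI.
pose a (k : nat) (j : 'I_n) : R := if j == i then c else k%:R.
have -> : (@tnth n R ^~ i \o (id : GT -> _)) @^-1` `]-oo, c[ =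
    \bigcup_k lower_orthant (a k).
  rewrite (bigcup_lower_orthant a [set i]).
  - apply/seteqP; split => x /=; rewrite in_itv/= /a; last first.
      by move=> /(_ i erefl); rewrite eqxx.
    by move=> xc j ->; rewrite eqxx.
  - by move=> j k /eqP; rewrite /a => /negbTE ->.
  - by move=> j k l ->; rewrite /a eqxx.
apply: bigcupT_measurable => k; apply: sub_sigma_algebra; by exists (a k).
Qed.

End lower_orthant.

(** * Equality of measures from equality of cosine integrals *)

Section fourier_uniqueness.
Context {R : realType} {n : nat}.
Variables mu nu : {measure set (n.-tuple R) -> \bar R}.
Hypotheses (muoo : (mu setT < +oo)%E) (nuoo : (nu setT < +oo)%E).
Hypothesis eq_cos : forall (xi : 'rV[R]_n) (eps : R),
  eps = 0 \/ eps = - (pi / 2) ->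
  (\int[mu]_x (cos (dotp x xi + eps))%:E =
   \int[nu]_x (cos (dotp x xi + eps))%:E)%E.

Local Notation H := (bounded_eq_integral mu nu).

Let H_ext f g : (forall x, f x = g x) -> H f -> H g.
Proof. by move=> /funext ->. Qed.

(** The two given phases are cosine and sine, and the addition formula expresses every other phase
    through them. *)
Let H_cos (xi : 'rV[R]_n) (th : R) : H (fun x => cos (dotp x xi + th)).
Proof.
have Hc eps : eps = 0 \/ eps = - (pi / 2) -> H (fun x => cos (dotp x xi + eps)).
  move=> e; split; [exact: measurable_cos_dotp| |exact: eq_cos].
  by exists 1 => x; rewrite ler_norml cos_geN1 cos_le1.
apply: (H_ext (fun x => cos th * cos (dotp x xi + 0) +
    (- sin th) * cos (dotp x xi + - (pi / 2)))).
  by move=> x; rewrite addr0 cosBpihalf cosD; lra.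
by apply: bounded_eq_integralD => //; apply: bounded_eq_integralZ => //; apply: Hc;
  [left|right].
Qed.

Let Tcos (g : n.-tuple R -> R) :=
  forall (xi : 'rV[R]_n) th, H (fun x => g x * cos (dotp x xi + th)).

(* The functions that preserve the class [Tcos] under multiplication form an
   algebra; it contains the cosines by the product-to-sum formula. *)
Let multiplier (f : n.-tuple R -> R) :=
  forall g, Tcos g -> Tcos (fun x => f x * g x).

Let multiplier_ext f g : (forall x, f x = g x) -> multiplier f -> multiplier g.
Proof. by move=> /funext ->. Qed.

Let multiplier_cst (a : R) : multiplier (fun=> a).
Proof.
move=> g Tg xi th; apply: (H_ext (fun x => a * (g x * cos (dotp x xi + th)))).
  by move=> x; rewrite mulrA.
by apply: bounded_eq_integralZ.
Qed.

Let multiplierD f g : multiplier f -> multiplier g ->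
  multiplier (fun x => f x + g x).
Proof.
move=> Mf Mg h Th xi th; apply: (H_ext (fun x =>
  f x * h x * cos (dotp x xi + th) + g x * h x * cos (dotp x xi + th))).
  by move=> x; rewrite !mulrDl.
by apply: bounded_eq_integralD => //; [exact: Mf|exact: Mg].
Qed.

Let multiplierM f g : multiplier f -> multiplier g ->
  multiplier (fun x => f x * g x).
Proof.
move=> Mf Mg h Th xi th.
apply: (H_ext (fun x => f x * (g x * h x) * cos (dotp x xi + th))).
  by move=> x; rewrite mulrA.
by apply: Mf; exact: Mg.
Qed.

Let multiplier_cos (xi : 'rV[R]_n) th : multiplier (fun x => cos (dotp x xi + th)).
Proof.
move=> g Tg eta ph; apply: (H_ext (fun x =>
  2^-1 * (g x * cos (dotp x (xi + eta) + (th + ph)) +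
          g x * cos (dotp x (xi - eta) + (th - ph))))).
  move=> x; rewrite !dotpD dotpN.
  have -> : dotp x xi + dotp x eta + (th + ph) =
    (dotp x xi + th) + (dotp x eta + ph) by lra.
  have -> : dotp x xi - dotp x eta + (th - ph) =
    (dotp x xi + th) - (dotp x eta + ph) by lra.
  by rewrite cosB cosD; lra.
by apply: bounded_eq_integralZ => //; apply: bounded_eq_integralD => //; exact: Tg.
Qed.

Let multiplier_exp f N : multiplier f -> multiplier (fun x => f x ^+ N).
Proof.
move=> Mf; elim: N => [|N ih]; first exact: (multiplier_cst 1).
apply: (multiplier_ext (fun x => f x * f x ^+ N)); last exact: multiplierM.
by move=> x; rewrite exprS.
Qed.

Let multiplier_prod (F : 'I_n -> n.-tuple R -> R) :
  (forall i, multiplier (F i)) -> multiplier (fun x => \prod_(i < n) F i x).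
Proof.
move=> MF; elim: (index_enum _) => [|i s ih].
  apply: (multiplier_ext (fun=> 1)) => [x|]; first by rewrite big_nil.
  exact: multiplier_cst.
apply: (multiplier_ext (fun x => F i x * \prod_(i <- s) F i x)) => [x|].
  by rewrite big_cons.
exact: multiplierM.
Qed.

Let multiplierH f : multiplier f -> H f.
Proof.
move=> Mf; have T1 : Tcos (fun=> 1).
  move=> xi th; apply: H_ext (H_cos xi th) => x; by rewrite mul1r.
apply: H_ext (Mf _ T1 0 0) => x.
by rewrite dotp0 addr0 cos0 !mulr1.
Qed.

(** A trigonometric polynomial with values in [[0, 1]], below [1 / 2] exactly where the sine is
    negative. Dividing by [k.+1] stretches the period, so that for large [k] this is where
    [x_i < a_i]. *)
Let S (a : 'I_n -> R) (k : nat) (i : 'I_n) (x : n.-tuple R) : R :=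
  (1 + sin ((tnth x i - a i) / k.+1%:R)) / 2.

Let S01 a k i x : 0 <= S a k i x <= 1.
Proof.
rewrite /S; have := sin_geN1 ((tnth x i - a i) / k.+1%:R).
have := sin_le1 ((tnth x i - a i) / k.+1%:R).
set s := sin _ => ? ?.
by apply/andP; split; lra.
Qed.

Let multiplier_step a k N :
  multiplier (fun x => \prod_(i < n) step_poly N (S a k i x)).
Proof.
apply: multiplier_prod => i; apply: multiplier_exp.
apply: (multiplier_ext (fun x => 1 + (-1) * S a k i x ^+ N)).
  by move=> x; rewrite mulN1r.
apply: multiplierD; first exact: multiplier_cst.
apply: multiplierM; first exact: multiplier_cst.
apply: multiplier_exp; apply: (multiplier_ext (fun x => 2^-1 + 2^-1 *
  cos (dotp x (k.+1%:R^-1 *: delta_mx ord0 i) + (- (a i / k.+1%:R) - pi / 2)))).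
  move=> x; rewrite dotp_delta addrA cosBpihalf /S mulrBl; lra.
apply: multiplierD; first exact: multiplier_cst.
by apply: multiplierM; [exact: multiplier_cst|exact: multiplier_cos].
Qed.

Let normr_prod01 (F : 'I_n -> R) : (forall i, 0 <= F i <= 1) ->
  `|\prod_(i < n) F i| <= 1.
Proof.
move=> F01; rewrite ger0_norm; first by apply: prodr_ile1 => i _; exact: F01.
by apply: prodr_ge0 => i _; have /andP[] := F01 i.
Qed.

Let cvg_prodr (F : 'I_n -> nat -> R) (l : 'I_n -> R) :
  (forall i, F i k @[k --> \oo] --> l i) ->
  \prod_(i < n) F i k @[k --> \oo] --> \prod_(i < n) l i.
Proof.
move=> Fl; elim: (index_enum _) => [|i s ih].
  rewrite big_nil; under eq_cvg do rewrite big_nil.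
  exact: cvg_cst.
rewrite big_cons; under eq_cvg do rewrite big_cons.
by apply: cvgM; [exact: Fl|exact: ih].
Qed.

Let H_step a k :
  H (fun x => \prod_(i < n) (if S a k i x < 1 / 2 then 1 else 0)).
Proof.
apply: (@bounded_eq_integral_lim _ _ _ _ _ muoo nuoo
  (fun N x => \prod_(i < n) step_poly N (S a k i x)) _ 1).
- by move=> N; apply: multiplierH; exact: multiplier_step.
- by move=> N x; apply: normr_prod01 => i; apply: step_poly_itv; exact: S01.
- by move=> x; apply: cvg_prodr => i; apply: cvg_step_poly; exact: S01.
Qed.

(** The sequence is eventually constant: once [|y / k.+1| < pi], the sine has the sign of [y]. *)
Let cvg_step_sin (y : R) :
  (if (1 + sin (y / k.+1%:R)) / 2 < 1 / 2 then 1 else 0 : R) @[k --> \oo] -->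
  (if y < 0 then 1 else 0 : R).
Proof.
have E : \forall k \near \oo,
    (if (1 + sin (y / k.+1%:R)) / 2 < 1 / 2 then 1 else 0) = (if y < 0 then 1 else 0 : R).
  near=> k.
  have yk : `|y / k.+1%:R| < pi.
    rewrite normrM normfV normr_nat ltr_pdivrMr//.
    rewrite -ltr_pdivrMl ?pi_gt0//.
    near: k; apply: filterS (nbhs_infty_gtr (pi^-1 * `|y|)) => k /lt_trans; apply.
    by rewrite ltr_nat.
  move: yk; rewrite ltr_norml => /andP[yk1 yk2].
  case: (ltP y 0) => y0.
    have : 0 < sin (- (y / k.+1%:R)).
      apply: sin_gt0_pi; rewrite ltrNl yk1 andbT oppr_gt0.
      by rewrite pmulr_llt0// invr_gt0.
    by rewrite sinN oppr_gt0; case: ifP => //; lra.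
  have : 0 <= sin (y / k.+1%:R).
    by apply: sin_ge0_pi; rewrite divr_ge0//= ltW.
  by case: ifP => //; lra.
exact: cvg_near_cst.
Unshelve. all: by end_near. Qed.

(** The limit in [N] was taken in [H_step]; the limit in [k] now turns the periodic steps into the
    indicator of the orthant. *)
Let lower_orthant_eq a : mu (lower_orthant a) = nu (lower_orthant a).
Proof.
have HI : H (fun x => \1_(lower_orthant a) x).
  apply: (@bounded_eq_integral_lim _ _ _ _ _ muoo nuoo (fun k x =>
    \prod_(i < n) (if S a k i x < 1 / 2 then 1 else 0)) _ 1).
  - by move=> k; exact: H_step.
  - by move=> k x; apply: normr_prod01 => i; case: ifP; rewrite lexx ler01.
  - move=> x.
    rewrite (_ : \1_(lower_orthant a) x =
      \prod_(i < n) (if tnth x i - a i < 0 then 1 else 0)); last first.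
      rewrite indicE; have [/set_mem xa|/negP xa] := boolP (x \in _).
        by rewrite big1// => i _; rewrite subr_lt0 xa.
      have [i xai] : exists i, ~ (tnth x i < a i).
        by apply/existsNP => h; apply: xa; rewrite inE.
      by rewrite (bigD1 i)//= subr_lt0 ifF ?mul0r//; exact/negP.
    by apply: cvg_prodr => i; exact: cvg_step_sin.
have [_ _] := HI; have ma := measurable_lower_orthant a.
by rewrite !integral_indic ?setIT.
Qed.

(** Lower orthants form a generating pi-system, since an intersection is the orthant of the
    coordinatewise minima, and countably many of finite measure cover the space. *)
Lemma measure_eq_cos A : measurable A -> mu A = nu A.
Proof.
move=> mA; apply: (measure_unique (range lower_orthant)
  (fun k => lower_orthant (fun=> k%:R))) => //.
- exact: measurable_tuple_lower_orthant.
- move=> _ _ [a _ <-] [b _ <-]; exists (fun i => Num.min (a i) (b i)) => //.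
  apply/seteqP; split => [x xab|x [xa xb] i]; last by rewrite lt_min xa xb.
  by split => i; have := xab i; rewrite lt_min => /andP[].
- apply: etrans (bigcup_lower_orthant (fun k _ => k%:R) set0 _ _) _ => //.
  by apply/seteqP; split => // x _ i [].
- by move=> _ [a _ <-]; exact: lower_orthant_eq.
- move=> k; apply: le_lt_trans muoo; apply: le_measure; rewrite ?inE//.
  exact: measurable_lower_orthant.
Qed.

End fourier_uniqueness.

(** * The moment functional *)

Section peval.
Context {R : realType} {n : nat}.
Implicit Types (p q : mpoly.mpoly n R) (x : n.-tuple R).

Lemma pevalD p q x : peval (p + q) x = peval p x + peval q x.
Proof. exact: mpoly.mevalD. Qed.

Lemma pevalN p x : peval (- p) x = - peval p x.
Proof. exact: mpoly.mevalN. Qed.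

Lemma pevalM p q x : peval (p * q) x = peval p x * peval q x.
Proof. exact: mpoly.mevalM. Qed.

Lemma pevalZ (a : R) p x : peval (a *: p) x = a * peval p x.
Proof. exact: mpoly.mevalZ. Qed.

Lemma peval0 x : peval (0 : mpoly.mpoly n R) x = 0.
Proof. exact: mpoly.meval0. Qed.

Lemma peval1 x : peval (1 : mpoly.mpoly n R) x = 1.
Proof. exact: mpoly.meval1. Qed.

Lemma pevalX i x : peval (mpoly.mpolyX R (mpoly.mnm1 i)) x = tnth x i.
Proof. exact: mpoly.mevalXU. Qed.

Section continuous_peval.
Context {T : topologicalType} (F : 'I_n -> T -> R).
Hypothesis cF : forall i, continuous (F i).

Let continuous_monomial (m : 'I_n -> nat) (s : seq 'I_n) :
  continuous (fun t => \prod_(i <- s) F i t ^+ m i).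
Proof.
elim: s => [|i s ih].
  rewrite (_ : (fun t => _) = (fun=> 1)); first by move=> t; exact: cvg_cst.
  by apply/funext => t; rewrite big_nil.
rewrite (_ : (fun t => _) = (fun t => F i t ^+ m i * \prod_(j <- s) F j t ^+ m j)).
  move=> t; apply: cvgM; last exact: ih.
  elim: (m i) => [|k IH]; first exact: cvg_cst.
  rewrite (_ : (fun u => _) = (fun u => F i u * F i u ^+ k)).
    by rewrite exprS; apply: cvgM => //; exact: cF.
  by apply/funext => u; rewrite exprS.
by apply/funext => t; rewrite big_cons.
Qed.

(** Phrased through continuous coordinate functions on a space [T], because it is applied to row
    vectors, which carry the topology, while polynomials are evaluated at tuples. *)
Lemma continuous_peval p : continuous (fun t => peval p [tuple F i t | i < n]).
Proof.
elim/mpoly.mpolyind: p => [|c m p _ _ ih].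
  rewrite (_ : (fun t => _) = (fun=> 0)); first by move=> t; exact: cvg_cst.
  by apply/funext => t; rewrite peval0.
rewrite (_ : (fun t => _) = (fun t =>
    c * (\prod_(i < n) F i t ^+ mpoly.fun_of_multinom m i) +
    peval p [tuple F i t | i < n])).
  move=> t; apply: cvgD; last exact: ih.
  by apply: cvgM; [exact: cvg_cst|exact: continuous_monomial].
apply/funext => t; rewrite pevalD pevalZ /peval mpoly.mevalX.
by under [in LHS]eq_bigr do rewrite tnth_mktuple.
Qed.

End continuous_peval.

Definition rowtuple (v : 'rV[R]_n) : n.-tuple R := [tuple v ord0 i | i < n].

Lemma tnth_rowtuple v i : tnth (rowtuple v) i = v ord0 i.
Proof. by rewrite tnth_mktuple. Qed.

Lemma rowtuple_row x : rowtuple (\row_i tnth x i) = x.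
Proof. by apply: eq_from_tnth => i; rewrite tnth_rowtuple mxE. Qed.

End peval.

Section moment_functional.
Context {R : realType} {n : nat} (mu : {measure set (n.-tuple R) -> \bar R}).
Hypothesis hmu : admissible mu.
Implicit Types (p q : mpoly.mpoly n R) (x : n.-tuple R).

Lemma admissible_lty : (mu setT < +oo)%E.
Proof.
have /integrableP[_] := hmu 1.
rewrite (eq_integral (cst 1%E)) ?integral_cst ?mul1e//.
by move=> x _; rewrite peval1 abse1.
Qed.

Lemma admissible_integrable (g : n.-tuple R -> R) p : measurable_fun setT g ->
  (forall x, `|g x| <= peval p x) -> mu.-integrable setT (EFin \o g).
Proof.
move=> mg gp; apply: le_integrable (hmu p) => //; first exact/measurable_EFinP.
by move=> x _; rewrite /= lee_fin (le_trans (gp x))// ler_norm.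
Qed.

Definition moment p : R := (\int[mu]_x peval p x)%R.

Lemma momentE p : (\int[mu]_x (peval p x)%:E)%E = (moment p)%:E.
Proof. by rewrite fineK//; apply: integrable_fin_num => //; exact: hmu. Qed.

Lemma momentD p q : moment (p + q) = moment p + moment q.
Proof.
rewrite /moment -RintegralD//; [|exact: hmu|exact: hmu].
by apply: eq_Rintegral => x _; rewrite pevalD.
Qed.

Lemma momentZ (a : R) p : moment (a *: p) = a * moment p.
Proof.
rewrite /moment -RintegralZl//; last exact: hmu.
by apply: eq_Rintegral => x _; rewrite pevalZ.
Qed.

Lemma momentN p : moment (- p) = - moment p.
Proof. by rewrite -scaleN1r momentZ mulN1r. Qed.

Lemma moment0 : moment 0 = 0.
Proof. by have := momentZ 0 0; rewrite scale0r mul0r. Qed.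

Lemma le_moment p q : (forall x, peval p x <= peval q x) -> moment p <= moment q.
Proof. by move=> pq; apply: le_Rintegral => //; exact: hmu. Qed.

Definition poly_bounded (g : n.-tuple R -> R) :=
  exists p, forall x, `|g x| <= peval p x.

Lemma poly_bounded0 : poly_bounded 0.
Proof. by exists 0 => x; rewrite peval0 normr0. Qed.

Lemma poly_boundedD g h : poly_bounded g -> poly_bounded h -> poly_bounded (g + h).
Proof.
move=> [p gp] [q hq]; exists (p + q) => x.
by rewrite pevalD (le_trans (ler_normD _ _))// lerD.
Qed.

Lemma poly_boundedZ (a : R) g : poly_bounded g -> poly_bounded (a *: g).
Proof.
move=> [p gp]; exists (`|a| *: p) => x.
by rewrite pevalZ normrM ler_wpM2l.
Qed.

Lemma poly_boundedN g : poly_bounded g -> poly_bounded (- g).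
Proof. by rewrite -scaleN1r; exact: poly_boundedZ. Qed.

Lemma bounded_poly_bounded (g : n.-tuple R -> R) M :
  (forall x, `|g x| <= M) -> poly_bounded g.
Proof. by move=> gM; exists (M *: 1) => x; rewrite pevalZ peval1 mulr1. Qed.

Lemma poly_bounded_peval p : poly_bounded (peval p).
Proof.
exists (p * p + 1) => x; rewrite pevalD pevalM peval1 ler_norml.
by apply/andP; split; nra.
Qed.

(** For [poly_bounded] functions the set is nonempty and bounded below, so that [inf] is a genuine
    real infimum. *)
Definition upper_moment (g : n.-tuple R -> R) : R :=
  inf [set moment q | q in [set q | forall x, g x <= peval q x]].

Lemma has_lbound_upper_moment g : poly_bounded g ->
  has_lbound [set moment q | q in [set q | forall x, g x <= peval q x]].
Proof.
move=> [p gp]; exists (moment (- p)) => _ [q gq <-]; apply: le_moment => x.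
rewrite pevalN (le_trans _ (gq x))// lerNl (le_trans _ (gp x))//.
by rewrite -normrN ler_norm.
Qed.

Lemma upper_moment_le g q : poly_bounded g -> (forall x, g x <= peval q x) ->
  upper_moment g <= moment q.
Proof.
by move=> bg gq; apply: ge_inf; [exact: has_lbound_upper_moment|exists q].
Qed.

Lemma upper_moment_neq0 g : poly_bounded g ->
  [set moment q | q in [set q | forall x, g x <= peval q x]] !=set0.
Proof.
by move=> [p gp]; exists (moment p), p => // x; rewrite (le_trans _ (gp x))// ler_norm.
Qed.

Lemma le_upper_moment g r : poly_bounded g ->
  (forall q, (forall x, g x <= peval q x) -> r <= moment q) -> r <= upper_moment g.
Proof.
move=> bg rq; apply: lb_le_inf; first exact: upper_moment_neq0.
by move=> _ [q gq <-]; exact: rq.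
Qed.

Lemma sublinear_upper_moment : sublinear_on poly_bounded upper_moment.
Proof.
split=> [g h bg bh|a g a0 bg].
  have bgh := poly_boundedD _ _ bg bh.
  suff : upper_moment (g + h) - upper_moment g <= upper_moment h by lra.
  apply: le_upper_moment => // q hq.
  suff : upper_moment (g + h) - moment q <= upper_moment g by lra.
  apply: le_upper_moment => // p gp; rewrite lerBlDr -momentD.
  by apply: upper_moment_le => // x; rewrite pevalD; exact: lerD.
move: a0; rewrite le_eqVlt => /predU1P[<-|a0].
  rewrite mul0r -[leRHS]moment0; apply: upper_moment_le; first exact: poly_boundedZ.
  by move=> x; rewrite peval0 scale0r.
rewrite mulrC -ler_pdivrMr//; apply: le_upper_moment => // q gq.
rewrite ler_pdivrMr// mulrC -momentZ; apply: upper_moment_le.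
  exact: poly_boundedZ.
by move=> x; rewrite pevalZ; apply: ler_wpM2l => //; exact: ltW.
Qed.

End moment_functional.

(** * The cosine bounds *)

Lemma cos_lipschitz {R : realType} (a b : R) : `|cos a - cos b| <= `|a - b|.
Proof.
wlog ab : a b / b <= a.
  move=> H; have [ab|/ltW ab] := leP b a; first exact: H.
  by rewrite distrC (distrC a); exact: H.
have [c _ ->] := @MVT_segment R cos (fun x => - sin x) b a ab
  (fun x _ => is_derive_cos x) (continuous_subspaceT (@continuous_cos R)).
rewrite normrM normrN -[leRHS]mul1r ler_wpM2r//.
by rewrite ler_norml sin_geN1 sin_le1.
Qed.

Section cosine_gap.
Context {R : realType} {n : nat} (mu : {measure set (n.-tuple R) -> \bar R}).
Hypothesis hmu : admissible mu.
Implicit Types (xi eta : 'rV[R]_n) (eps : R).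

Definition cosfun xi eps (x : n.-tuple R) : R := cos (dotp x xi + eps).

Lemma normr_cosfun xi eps x : `|cosfun xi eps x| <= 1.
Proof. by rewrite ler_norml cos_geN1 cos_le1. Qed.

Lemma poly_bounded_cosfun xi eps : poly_bounded (cosfun xi eps).
Proof. by apply: bounded_poly_bounded => x; exact: normr_cosfun. Qed.

Lemma cosfun_integrable xi eps : mu.-integrable setT (EFin \o cosfun xi eps).
Proof.
apply: (admissible_integrable mu hmu _ 1); first exact: measurable_cos_dotp.
by move=> x; rewrite peval1 normr_cosfun.
Qed.

Lemma upper_bound_cosE xi eps :
  upper_bound_cos mu xi eps = (upper_moment mu (cosfun xi eps))%:E.
Proof.
rewrite -ereal_inf_EFin; last 2 first.
- exact/has_lbound_upper_moment/poly_bounded_cosfun.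
- exact/upper_moment_neq0/poly_bounded_cosfun.
rewrite image_comp /upper_bound_cos; congr ereal_inf.
by apply: eq_imagel => q _; exact: momentE.
Qed.

(** Negation exchanges polynomial minorants of the cosine with polynomial majorants of its
    opposite. *)
Lemma lower_bound_cosE xi eps :
  lower_bound_cos mu xi eps = (- upper_moment mu (- cosfun xi eps))%:E.
Proof.
rewrite EFinN -ereal_inf_EFin; last 2 first.
- exact/has_lbound_upper_moment/poly_boundedN/poly_bounded_cosfun.
- exact/upper_moment_neq0/poly_boundedN/poly_bounded_cosfun.
rewrite /ereal_inf; apply: etrans (esym (oppeK _)).
rewrite !image_comp /lower_bound_cos; congr ereal_sup.
apply/seteqP; split=> [_ [p pc <-]|_ [q cq <-]].
  exists (- p) => [x|] /=; first by rewrite pevalN lerN2; exact: pc.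
  by rewrite momentN// momentE// -[in RHS](opprK (moment mu p)).
exists (- q) => [x|] /=; first by rewrite pevalN lerNl; exact: cq.
by rewrite momentE// momentN.
Qed.

(** Adding [q] to a majorant of [g] gives a majorant of [h]. *)
Lemma upper_moment_leD g h q : poly_bounded g -> poly_bounded h ->
  (forall x, h x - g x <= peval q x) ->
  upper_moment mu h <= upper_moment mu g + moment mu q.
Proof.
move=> bg bh hgq; rewrite -lerBlDr; apply: le_upper_moment => // p gp.
rewrite lerBlDr -momentD//; apply: upper_moment_le => // x.
by rewrite pevalD; have := hgq x; have := gp x; lra.
Qed.

(** A polynomial that dominates the sum of the [|x_i|], by [|t| <= 1 + t ^ 2]; it makes the
    Lipschitz bound of the cosine integrable by moments. *)
Let quad : mpoly.mpoly n R := \sum_(i < n)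
  (1 + mpoly.mpolyX R (mpoly.mnm1 i) * mpoly.mpolyX R (mpoly.mnm1 i)).

Let quadE x : peval quad x = \sum_(i < n) (1 + tnth x i * tnth x i).
Proof.
rewrite /quad (big_morph (fun p => peval p x) (fun p q => pevalD p q x) (peval0 x)).
by apply: eq_bigr => i _; rewrite pevalD pevalM peval1 !pevalX.
Qed.

Let cosfun_dist xi eta eps (d : R) x : (forall i, `|xi ord0 i - eta ord0 i| <= d) ->
  `|cosfun xi eps x - cosfun eta eps x| <= peval (d *: quad) x.
Proof.
move=> xid; apply: (le_trans (cos_lipschitz _ _)).
rewrite pevalZ quadE opprD addrACA subrr addr0 -dotpN -dotpD mulr_sumr.
apply: (le_trans (ler_norm_sum _ _ _)); apply: ler_sum => i _.
rewrite !mxE normrM mulrC.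
apply: ler_pM => //.
have := normr_ge0 (tnth x i); rewrite -[tnth x i * tnth x i]expr2 -[_ ^+ 2]real_normK ?num_real//.
by set u := `|_|; nra.
Qed.

Let gap xi eps := upper_moment mu (cosfun xi eps) + upper_moment mu (- cosfun xi eps).

Lemma lower_lt_upper_cosE xi eps :
  (lower_bound_cos mu xi eps < upper_bound_cos mu xi eps)%E = (0 < gap xi eps).
Proof. by rewrite lower_bound_cosE upper_bound_cosE lte_fin ltrNl -subr_gt0 opprK /gap addrC. Qed.

Lemma open_lower_lt_upper_cos eps : open [set xi : 'rV[R]_n | xi != 0 /\
  (lower_bound_cos mu xi eps < upper_bound_cos mu xi eps)%E].
Proof.
rewrite openE => xi [xi0]; rewrite lower_lt_upper_cosE => gap0.
(* Each of the two upper moments changes by at most [d * moment mu quad]. With [d = gap / (2 * c)]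
   the total change stays below the gap, and the summand 1 makes this strict and [c] positive. *)
pose c := 1 + `|moment mu quad|.
have c0 : 0 < c by rewrite ltr_pwDl.
apply/nbhs_ballP; exists (gap xi eps / (2 * c)); first by rewrite /= divr_gt0// mulr_gt0.
move=> eta [_ xieta] /=.
set d := gap xi eps / (2 * c) in xieta.
have dist i : `|xi ord0 i - eta ord0 i| <= d by apply/ltW/xieta.
have d0 : 0 <= d by rewrite divr_ge0 ?mulr_ge0// ltW.
have gap_eta : 0 < gap eta eps.
  have h1 : upper_moment mu (cosfun xi eps) <=
      upper_moment mu (cosfun eta eps) + moment mu (d *: quad).
    apply: upper_moment_leD; [exact: poly_bounded_cosfun|exact: poly_bounded_cosfun|].
    by move=> x; apply: le_trans (ler_norm _) _; exact: cosfun_dist.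
  have h2 : upper_moment mu (- cosfun xi eps) <=
      upper_moment mu (- cosfun eta eps) + moment mu (d *: quad).
    apply: upper_moment_leD; [exact/poly_boundedN/poly_bounded_cosfun|
      exact/poly_boundedN/poly_bounded_cosfun|].
    move=> x; apply: le_trans (cosfun_dist xi eta eps d x dist).
    by rewrite -normrN; apply: le_trans (ler_norm _); rewrite opprB addrC opprK.
  have h3 : moment mu (d *: quad) * 2 < gap xi eps.
    rewrite momentZ//.
    have dc : d * c * 2 = gap xi eps by rewrite /d; field; rewrite gt_eqF.
    have dlt : 0 < d by rewrite divr_gt0// mulr_gt0.
    have : d * moment mu quad < d * c.
      by rewrite ltr_pM2l// /c; have := ler_norm (moment mu quad); lra.
    lra.
  by move: h1 h2 h3; rewrite /gap; lra.
split; last by rewrite lower_lt_upper_cosE.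
(* At frequency 0 the cosine is a constant polynomial, so the gap would be at most 0. *)
apply/eqP => eta0; move: gap_eta; apply/negP; rewrite -leNgt.
have ce x : cosfun eta eps x = cos eps by rewrite /cosfun eta0 dotp0 add0r.
have h1 : upper_moment mu (cosfun eta eps) <= moment mu (cos eps *: 1).
  apply: upper_moment_le => //; first exact: poly_bounded_cosfun.
  by move=> x; rewrite pevalZ peval1 mulr1 ce.
have h2 : upper_moment mu (- cosfun eta eps) <= moment mu (- (cos eps *: 1)).
  apply: upper_moment_le => //; first exact/poly_boundedN/poly_bounded_cosfun.
  by move=> x; rewrite pevalN pevalZ peval1 mulr1 lerN2 ce.
by move: h1 h2; rewrite momentN// /gap; lra.
Qed.

Lemma lower_le_integral_cos xi eps :
  (lower_bound_cos mu xi eps <= \int[mu]_x (cos (dotp x xi + eps))%:E)%E.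
Proof.
apply: ge_ereal_sup => _ [p pc <-]; apply: le_integral => //.
- exact: (cosfun_integrable xi eps).
- by move=> x _; rewrite lee_fin; exact: pc.
Qed.

Lemma integral_cos_le_upper xi eps :
  (\int[mu]_x (cos (dotp x xi + eps))%:E <= upper_bound_cos mu xi eps)%E.
Proof.
apply: le_ereal_inf_tmp => _ [p pc <-]; apply: le_integral => //.
- exact: (cosfun_integrable xi eps).
- by move=> x _; rewrite lee_fin; exact: pc.
Qed.

End cosine_gap.

Lemma moment_equiv_lower_bound_cos {R : realType} {n : nat}
  (mu nu : {measure set (n.-tuple R) -> \bar R}) xi eps : moment_equiv mu nu ->
  lower_bound_cos mu xi eps = lower_bound_cos nu xi eps.
Proof. by move=> e; congr ereal_sup; apply: eq_imagel => p _; exact: e. Qed.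

Lemma moment_equiv_upper_bound_cos {R : realType} {n : nat}
  (mu nu : {measure set (n.-tuple R) -> \bar R}) xi eps : moment_equiv mu nu ->
  upper_bound_cos mu xi eps = upper_bound_cos nu xi eps.
Proof. by move=> e; congr ereal_inf; apply: eq_imagel => p _; exact: e. Qed.

(** Without a gap, the integrals of each cosine against [mu] and [nu] are both pinned to the common
    value of the two bounds, and Fourier uniqueness identifies the measures. *)
Lemma moment_equiv_differs_gap {R : realType} {n : nat}
  (mu nu : {measure set (n.-tuple R) -> \bar R}) :
  admissible mu -> admissible nu -> moment_equiv mu nu -> measure_differs mu nu ->
  exists (xi : 'rV[R]_n) (eps : R), [/\ xi != 0, (eps = 0 \/ eps = - (pi / 2))
    & (lower_bound_cos mu xi eps < upper_bound_cos mu xi eps)%E].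
Proof.
move=> hmu hnu e [A [mA nuA]]; apply: contrapT => H; apply: nuA; apply/esym.
apply: (measure_eq_cos mu nu) => //; [exact: admissible_lty|exact: admissible_lty|].
(* Frequency 0 is outside the reach of [H], but there the cosine is a constant, whose integral is a
   moment. *)
move=> xi eps he; have [->|xi0] := eqVneq xi 0.
  have E (m : {measure set (n.-tuple R) -> \bar R}) :
      (\int[m]_x (cos (dotp x 0%R + eps))%:E = \int[m]_x (peval (cos eps *: 1) x)%:E)%E.
    by apply: eq_integral => x _; rewrite dotp0 add0r pevalZ peval1 mulr1.
  by rewrite !E; exact: e.
have UL : (upper_bound_cos mu xi eps <= lower_bound_cos mu xi eps)%E.
  by rewrite leNgt; apply/negP => lu; apply: H; exists xi, eps.
have E (m : {measure set (n.-tuple R) -> \bar R}) : admissible m -> moment_equiv mu m ->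
    (\int[m]_x (cos (dotp x xi + eps))%:E = lower_bound_cos mu xi eps)%E.
  move=> hm em; apply/eqP; rewrite eq_le; apply/andP; split.
    apply: le_trans UL; rewrite (moment_equiv_upper_bound_cos _ _ _ _ em).
    exact: integral_cos_le_upper.
  rewrite (moment_equiv_lower_bound_cos _ _ _ _ em); exact: lower_le_integral_cos.
by rewrite !E.
Qed.

(** * Representation of positive functionals *)

Lemma continuous_addr {R : realType} {T : topologicalType} {f g : T -> R} :
  continuous f -> continuous g -> continuous (fun t => f t + g t).
Proof. by move=> cf cg t; apply: cvgD; [exact: cf|exact: cg]. Qed.

Section representation.
Context {R : realType} {n : nat} (mu : {measure set (n.-tuple R) -> \bar R}).
Hypothesis hmu : admissible mu.
Variable L : (n.-tuple R -> R) -> R.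
Hypothesis L_le_upper : forall g, poly_bounded g -> L g <= upper_moment mu g.
Hypothesis LD : forall g h, poly_bounded g -> poly_bounded h ->
  L (g + h) = L g + L h.
Hypothesis LZ : forall (a : R) g, poly_bounded g -> L (a *: g) = a * L g.
Implicit Types (p q : mpoly.mpoly n R) (x : n.-tuple R) (v : 'rV[R]_n).

Let LN g : poly_bounded g -> L (- g) = - L g.
Proof. by move=> bg; rewrite -scaleN1r LZ// mulN1r. Qed.

Lemma positive_le_moment g p : poly_bounded g -> (forall x, g x <= peval p x) ->
  L g <= moment mu p.
Proof. by move=> bg gp; apply: le_trans (L_le_upper g bg) _; exact: upper_moment_le. Qed.

(** The bound by moments is applied to [p] and to [- p]. *)
Lemma positive_moment p : L (peval p) = moment mu p.
Proof.
apply/eqP; rewrite eq_le positive_le_moment//=; last exact: poly_bounded_peval.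
rewrite -lerN2 -LN; last exact: poly_bounded_peval.
rewrite -momentN//; apply: positive_le_moment => [|x]; last by rewrite pevalN.
exact/poly_boundedN/poly_bounded_peval.
Qed.

(** The difference [g - h] has the zero polynomial as a majorant. *)
Lemma positive_le g h : poly_bounded g -> poly_bounded h ->
  (forall x, g x <= h x) -> L g <= L h.
Proof.
move=> bg bh gh; rewrite -subr_le0 -LN// -LD//; last exact: poly_boundedN.
rewrite -(moment0 mu hmu); apply: positive_le_moment => [|x].
  by apply: poly_boundedD => //; exact: poly_boundedN.
by rewrite peval0 [leLHS](_ : _ = g x - h x)// subr_le0.
Qed.

Definition row_of (x : n.-tuple R) : 'rV[R]_n := \row_i tnth x i.

Let ind (A : set 'rV[R]_n) : n.-tuple R -> R := fun x => \1_A (row_of x).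

Let poly_bounded_ind A : poly_bounded (ind A).
Proof.
apply: (bounded_poly_bounded _ 1) => x; rewrite /ind indicE.
by case: (_ \in _); rewrite ?normr1 ?normr0.
Qed.

Definition positive_content (A : set 'rV[R]_n) : R := L (ind A).

Let L0 : L 0 = 0.
Proof. by rewrite -(scale0r (0 : n.-tuple R -> R)) LZ ?mul0r//; exact: poly_bounded0. Qed.

Let positive_content_ge0 A : 0 <= positive_content A.
Proof.
rewrite -L0; apply: positive_le => //; first exact: poly_bounded0.
Qed.

Let positive_contentU A B : A `&` B = set0 ->
  positive_content (A `|` B) = positive_content A + positive_content B.
Proof.
move=> AB; rewrite /positive_content -LD//; congr L; apply/funext => x.
rewrite [RHS](_ : _ = ind A x + ind B x)// /ind !indicE in_setU.
have [/set_mem Ax|] := boolP (row_of x \in A); last by rewrite add0r.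
by rewrite memNset ?addr0// => Bx; have : set0 (row_of x) by rewrite -AB; split.
Qed.

Let sumsq : mpoly.mpoly n R := \sum_(i < n)
  (mpoly.mpolyX R (mpoly.mnm1 i) * mpoly.mpolyX R (mpoly.mnm1 i)).

Let sumsqE x : peval sumsq x = \sum_(i < n) tnth x i * tnth x i.
Proof.
rewrite /sumsq (big_morph (fun p => peval p x) (fun p q => pevalD p q x) (peval0 x)).
by apply: eq_bigr => i _; rewrite pevalM !pevalX.
Qed.

(* Chebyshev's inequality for the second moments. *)
Let positive_content_tight e : 0 < e ->
  exists K, [/\ compact K, closed K & positive_content (~` K) < e].
Proof.
(* Outside the box of half-width [M] the sum of squares is at least [M * M]. This [M] gives
   [C < e * M] and, being at least 1, [e * M <= e * (M * M)]. *)
move=> e0; pose C : R := `|moment mu sumsq|; pose M : R := 1 + C / e.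
have M1 : 1 <= M by rewrite lerDl divr_ge0 ?normr_ge0 ?(ltW e0).
have M0 : 0 < M by exact: lt_le_trans M1.
exists [set v : 'rV[R]_n | forall i, `[- M, M]%classic (v ord0 i)]; split.
- by apply: (@rV_compact _ _ (fun=> `[- M, M]%classic)) => _; exact: segment_compact.
- rewrite (_ : [set v | _] = \bigcap_(i in setT) ((fun v : 'rV[R]_n => v ord0 i) @^-1` `[- M, M])).
    apply: closed_bigI => i _.
    have /continuous_closedP := @coord_continuous R 1 n ord0 i.
    by apply; exact: interval_closed.
  by apply/seteqP; split=> [v vM i _|v vM i]; [exact: vM|exact: (vM i I)].
apply: (@le_lt_trans _ _ (moment mu ((M * M)^-1 *: sumsq))).
  apply: positive_le_moment => // x; rewrite pevalZ sumsqE /ind indicE.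
  have s0 : 0 <= \sum_(i < n) tnth x i * tnth x i.
    by apply: sumr_ge0 => i _; rewrite -expr2 sqr_ge0.
  have [/set_mem/existsNP[i xi]|_] := boolP (row_of x \in _); last first.
    by rewrite mulr_ge0// invr_ge0 mulr_ge0// ltW.
  rewrite ler_pdivlMl ?mulr_gt0// mulr1.
  apply: (@le_trans _ _ (tnth x i * tnth x i)).
    have : ~~ (`|tnth x i| <= M).
      by apply/negP => h; apply: xi; rewrite /= in_itv/= mxE -ler_norml.
    rewrite -ltNge => Mx; rewrite -[leRHS]expr2 -real_normK ?num_real//.
    by rewrite expr2; apply: ler_pM; rewrite ?ltW.
  by rewrite (bigD1 i)//= lerDl; apply: sumr_ge0 => j _; rewrite -expr2 sqr_ge0.
rewrite momentZ// mulrC ltr_pdivrMr ?mulr_gt0//.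
apply: (@le_lt_trans _ _ C); first exact: ler_norm.
apply: (@lt_le_trans _ _ (e * M)).
  by rewrite /M mulrDr mulr1 mulrCA divff ?gt_eqF// mulr1 ltrDr.
by rewrite ler_pM2l// ler_peMl// ltW.
Qed.

Definition content_of_positive : tight_content R 'rV[R]_n :=
  TightContent _ _ positive_content positive_content_ge0 positive_contentU
    positive_content_tight.

Local Notation tc := (tc_measure content_of_positive).
Local Notation gT :=
  (g_sigma_algebraType (@measurable _ (regular_type content_of_positive))).

Let regular_setT : regular_set content_of_positive setT.
Proof. by rewrite -setC0; apply: regular_setC; exact: regular_set0. Qed.

Lemma tc_setT : tc setT = (moment mu 1)%:E.
Proof.
rewrite tc_measureE//= -positive_moment; congr (L _)%:E.
by apply/funext => x; rewrite /ind indicT peval1.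
Qed.

Lemma tc_lty : (tc setT < +oo)%E. Proof. by rewrite tc_setT ltry. Qed.

Lemma bounded_tc_integrable (g : 'rV[R]_n -> R) B : continuous g ->
  (forall v, `|g v| <= B) -> tc.-integrable setT (EFin \o (g : gT -> R)).
Proof.
move=> cg gB; apply: measurable_bounded_integrable => //; first exact: tc_lty.
  exact: continuous_measurable_tc.
exists B; split; first exact: num_real.
by move=> N BN x _; apply: le_trans (gB x) _; exact: ltW.
Qed.

(** Integral and [L] agree on staircases of regular sets. Both are monotone, so replacing [g] by a
    staircase within [e] changes each by at most [e] times the total mass. *)
Lemma Rintegral_tc (g : 'rV[R]_n -> R) B : continuous g ->
  (forall v, 0 <= g v <= B) -> (\int[tc]_v (g : gT -> R) v)%R = L (g \o row_of).
Proof.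
move=> cg gB.
have ngB v : `|g v| <= B by have /andP[? ?] := gB v; rewrite ger0_norm.
have ig := bounded_tc_integrable g B cg ngB.
have bg : poly_bounded (g \o row_of) by apply: (bounded_poly_bounded _ B) => x; exact: ngB.
pose P (s : 'rV[R]_n -> R) := [/\ poly_bounded (s \o row_of),
  tc.-integrable setT (EFin \o (s : gT -> R)) &
  (\int[tc]_v (s : gT -> R) v)%R = L (s \o row_of)].
pose C := moment mu 1.
have C0 : 0 <= C by rewrite -lee_fin -tc_setT.
suff approx e : 0 < e -> `|(\int[tc]_v (g : gT -> R) v)%R - L (g \o row_of)| <= e * C.
  apply/eqP; rewrite -subr_eq0 -normr_le0; apply/ler_addgt0Pr => e e0.
  (* The tolerance is divided by [1 + C] because the mass [C] may be 0. *)
  rewrite add0r; have eC : 0 < e / (1 + C) by rewrite divr_gt0// ltr_pwDl.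
  apply: le_trans (approx _ eC) _; rewrite -mulrA ler_piMr ?(ltW e0)//.
  by rewrite mulrC ler_pdivrMr ?ltr_pwDl//; lra.
move=> e0; have [||s [bs is_ Ps] gs] :=
  @continuous_staircase R _ content_of_positive P _ _ g B cg gB e e0.
- have E0 : (fun=> 0) \o row_of = 0 :> (n.-tuple R -> R) by [].
  split; rewrite ?E0 ?L0; first exact: poly_bounded0.
    exact: integrable0.
  by rewrite Rintegral_cst// mul0r.
- move=> s t A t0 [bs is_ Ps] rA.
  have mA := measurable_regular content_of_positive A rA.
  have E : (fun v => s v + t * \1_A v) \o row_of = (s \o row_of) + t *: ind A by [].
  have iA : tc.-integrable setT (EFin \o (\1_A : gT -> R)).
    apply: measurable_bounded_integrable => //; first exact: tc_lty.
    exists 1; split; first exact: num_real.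
    move=> N N1 v _ /=; rewrite indicE.
    by apply: le_trans (ltW N1); case: (_ \in _); rewrite ?normr1 ?normr0.
  have itA : tc.-integrable setT (EFin \o (fun v : gT => t * \1_A v)).
    have := @integrableZl _ _ _ tc setT measurableT t _ iA.
    by apply: eq_integrable.
  have btA : poly_bounded (t *: ind A) by exact: poly_boundedZ.
  split.
  + by rewrite E; exact: poly_boundedD.
  + by have := integrableD measurableT is_ itA; apply: eq_integrable.
  + rewrite E LD// LZ// RintegralD// Ps RintegralZl//; congr (_ + _ * _).
    rewrite /Rintegral integral_indic// setIT.
    by rewrite tc_measureE.
pose u : n.-tuple R -> R := peval 1.
have one : poly_bounded (e *: u) by apply: poly_boundedZ; exact: poly_bounded_peval.
have Lone : L (e *: u) = e * C.
  by rewrite LZ ?positive_moment//; exact: poly_bounded_peval.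
have L1 : L (s \o row_of) <= L (g \o row_of).
  by apply: positive_le => // x /=; have /andP[? _] := gs (row_of x); lra.
have L2 : L (g \o row_of) <= L (s \o row_of) + e * C.
  rewrite -Lone -LD//; apply: positive_le => //; first exact: poly_boundedD.
  move=> x; rewrite [leRHS](_ : _ = s (row_of x) + e * u x)// /u peval1 mulr1 /=.
  by have /andP[_ ?] := gs (row_of x); lra.
have ie : tc.-integrable setT (EFin \o (cst e : gT -> R)).
  by apply: (bounded_tc_integrable (cst e) `|e|) => // v; exact: cst_continuous.
have I1 : (\int[tc]_v (s : gT -> R) v <= \int[tc]_v (g : gT -> R) v)%R.
  by apply: le_Rintegral => // v _; have /andP[? _] := gs v; lra.
have I2 : (\int[tc]_v (g : gT -> R) v <= \int[tc]_v (s : gT -> R) v + e * C)%R.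
  have <- : (\int[tc]_v (cst e : gT -> R) v)%R = e * C.
    by rewrite Rintegral_cst// tc_setT.
  rewrite -RintegralD//; apply: le_Rintegral => //.
    by have := integrableD measurableT is_ ie; apply: eq_integrable.
  by move=> v _; have /andP[_ ?] := gs v; rewrite /=; lra.
by rewrite ler_norml; apply/andP; split; lra.
Qed.

Let continuous_peval_rowtuple p :
  continuous (fun v : 'rV[R]_n => peval p (rowtuple v)).
Proof.
exact: (@continuous_peval R n 'rV[R]_n (fun i v => v ord0 i)
  (fun i => @coord_continuous R 1 n ord0 i) p).
Qed.

Let measurable_peval_rowtuple p :
  measurable_fun setT (fun v : gT => peval p (rowtuple v)).
Proof. exact: continuous_measurable_tc. Qed.

(** [L] is only finitely additive, so the tail is controlled by a higher moment:
    [p - p ^ 2 / K <= min (p, K) <= p], and the moment of [p ^ 2 / K] tends to 0. *)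
Let cvg_truncated_moment p : (forall x, 0 <= peval p x) ->
  L (fun x => Num.min (peval p x) k.+1%:R) @[k --> \oo] --> moment mu p.
Proof.
move=> p0; have bk k : poly_bounded (fun x => Num.min (peval p x) k.+1%:R).
  apply: (bounded_poly_bounded _ k.+1%:R) => x.
  by rewrite ger0_norm ?ge_min ?lexx ?orbT// le_min p0/=.
apply: (@squeeze_cvgr _ _ _ _
  (fun k => moment mu p - k.+1%:R^-1 * moment mu (p * p)) (cst (moment mu p))).
- apply: nearW => k; apply/andP; split; last first.
    by apply: positive_le_moment => // x; rewrite ge_min lexx.
  rewrite -momentZ// -momentN// -momentD// -positive_moment.
  apply: positive_le => // [|x]; first exact: poly_bounded_peval.
  rewrite pevalD pevalN pevalZ pevalM le_min; set K : R := k.+1%:R.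
  have K0 : 0 < K by rewrite ltr0n.
  apply/andP; split; first by rewrite gerBl mulr_ge0 ?invr_ge0 ?mulr_ge0 ?(ltW K0).
  rewrite lerBlDr -(ler_pM2l K0) mulrDr mulVKf ?gt_eqF//.
  by have := sqr_ge0 (K - peval p x); have := p0 x; nra.
- rewrite -[X in _ --> X]subr0 -(mul0r (moment mu (p * p))).
  apply: cvgB; first exact: cvg_cst.
  by apply: cvgM; [exact: cvg_harmonic|exact: cvg_cst].
- exact: cvg_cst.
Qed.

(** Truncations are bounded and continuous, so their integrals are values of [L]; monotone
    convergence on one side meets [cvg_truncated_moment] on the other. *)
Let integral_tc_nneg_poly p : (forall x, 0 <= peval p x) ->
  (\int[tc]_v (peval p (rowtuple (v : gT)))%:E)%E = (moment mu p)%:E.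
Proof.
move=> p0; pose g (k : nat) (v : 'rV[R]_n) := Num.min (peval p (rowtuple v)) k.+1%:R.
have cg k : continuous (g k).
  move=> v; apply: (@continuous_min _ _ (fun v => peval p (rowtuple v)) (fun=> k.+1%:R)).
    exact: continuous_peval_rowtuple.
  exact: cst_continuous.
have g01 k v : 0 <= g k v <= k.+1%:R by rewrite ge_min lexx orbT andbT le_min p0/=.
have gk k : (\int[tc]_v (g k (v : gT))%:E)%E =
    (L (fun x => Num.min (peval p x) k.+1%:R))%:E.
  rewrite -[LHS]fineK; last first.
    apply: integrable_fin_num => //.
    apply: (bounded_tc_integrable (g k) k.+1%:R) => // v.
    by have /andP[? ?] := g01 k v; rewrite ger0_norm.
  congr EFin; apply: etrans (Rintegral_tc (g k) k.+1%:R (cg k) (g01 k)) _.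
  by congr L; apply/funext => x; rewrite /g/= rowtuple_row.
have mg k : measurable_fun setT (EFin \o (g k : gT -> R)).
  by apply/measurable_EFinP; exact: continuous_measurable_tc.
have g0 k (v : gT) : setT v -> (0 <= (EFin \o (g k : gT -> R)) v)%E.
  by move=> _; rewrite lee_fin; have /andP[] := g01 k v.
have ndg (v : gT) : setT v -> nondecreasing_seq ((fun k => (g k v)%:E)).
  move=> _ k l kl; rewrite lee_fin /g le_min ge_min lexx/= ge_min.
  by rewrite ler_nat ltnS kl orbT.
have := @cvg_monotone_convergence _ gT R tc setT measurableT
  (fun k => EFin \o (g k : gT -> R)) mg g0 ndg.
rewrite [X in _ --> X](_ : _ = \int[tc]_v (peval p (rowtuple (v : gT)))%:E)%E; last first.
  apply: eq_integral => v _; apply: cvg_lim => //.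
  apply: cvg_near_cst; near=> k; congr EFin; rewrite /g min_l//.
  apply: ltW; apply: (@lt_trans _ _ k%:R); last by rewrite ltr_nat.
  by near: k; exact: nbhs_infty_gtr.
move=> h; apply: cvg_unique h _ => //.
rewrite (_ : (fun k => _) = (fun k =>
  (L (fun x => Num.min (peval p x) k.+1%:R))%:E)); last by apply/funext => k; exact: gk.
apply: cvg_EFin; first exact: nearW.
exact: cvg_truncated_moment.
Unshelve. all: by end_near. Qed.

Let tc_integrable_poly p :
  tc.-integrable setT (fun v : gT => (peval p (rowtuple v))%:E).
Proof.
have sq0 x : 0 <= peval (p * p + 1) x.
  by rewrite pevalD pevalM peval1 addr_ge0// -expr2 sqr_ge0.
apply: (@le_integrable _ _ _ tc setT measurableT _
    (fun v : gT => (peval (p * p + 1) (rowtuple v))%:E)).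
- exact/measurable_EFinP.
- move=> v _; rewrite lee_fin (ger0_norm (sq0 _)) pevalD pevalM peval1 ler_norml.
  by apply/andP; split; nra.
- apply/integrableP; split; first exact/measurable_EFinP.
  under eq_integral do rewrite gee0_abs ?lee_fin//.
  by rewrite integral_tc_nneg_poly// ltry.
Qed.

(** Write [p] as the difference of the nonnegative polynomials [p ^ 2 + 1 + p] and [p ^ 2 + 1]. *)
Let integral_tc_poly p :
  (\int[tc]_v (peval p (rowtuple (v : gT)))%:E)%E = (moment mu p)%:E.
Proof.
have sq0 x : 0 <= peval (p * p + 1) x.
  by rewrite pevalD pevalM peval1 addr_ge0// -expr2 sqr_ge0.
have sqp0 x : 0 <= peval (p * p + 1 + p) x.
  by rewrite !pevalD pevalM peval1; nra.
under eq_integral => v _.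
  rewrite (_ : peval p (rowtuple v) = peval (p * p + 1 + p) (rowtuple v) -
    peval (p * p + 1) (rowtuple v)); last by rewrite (pevalD _ p) addrAC subrr add0r.
  rewrite EFinB; over.
rewrite integralB//=.
rewrite !integral_tc_nneg_poly// -EFinB (momentD _ _ _ p)//.
by rewrite addrAC subrr add0r.
Qed.

Let dotp_poly (xi : 'rV[R]_n) : exists p, forall x, dotp x xi = peval p x.
Proof.
exists (\sum_(i < n) xi ord0 i *: mpoly.mpolyX R (mpoly.mnm1 i)) => x.
rewrite (big_morph (fun p => peval p x) (fun p q => pevalD p q x) (peval0 x)).
by apply: eq_bigr => i _; rewrite pevalZ pevalX mulrC.
Qed.

Let continuous_cosfun_rowtuple xi eps :
  continuous (fun v : 'rV[R]_n => cosfun xi eps (rowtuple v)).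
Proof.
have [p pE] := dotp_poly xi => v.
apply: (@continuous_comp _ _ _ (fun v => dotp (rowtuple v) xi + eps) cos).
  rewrite (_ : (fun v => _) = (fun v => peval (p + eps *: 1) (rowtuple v))).
    exact: continuous_peval_rowtuple.
  by apply/funext => w; rewrite pE pevalD pevalZ peval1 mulr1.
exact: continuous_cos.
Qed.

Let tc_integrable_cos xi eps :
  tc.-integrable setT (fun v : gT => (cosfun xi eps (rowtuple v))%:E).
Proof.
apply: (bounded_tc_integrable (fun v => cosfun xi eps (rowtuple v)) 1).
  exact: continuous_cosfun_rowtuple.
by move=> v; exact: normr_cosfun.
Qed.

(** [Rintegral_tc] asks for a nonnegative function, so it is applied to the cosine plus 1, with
    values in [[0, 2]], and the constant is then cancelled. *)
Let Rintegral_tc_cos xi eps :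
  (\int[tc]_v (cosfun xi eps (rowtuple (v : gT))))%R = L (cosfun xi eps).
Proof.
pose u : n.-tuple R -> R := peval 1.
have i1 : tc.-integrable setT (EFin \o (fun v : gT => peval 1 (rowtuple v))).
  exact: tc_integrable_poly.
have := Rintegral_tc (fun v => cosfun xi eps (rowtuple v) + peval 1 (rowtuple v)) 2.
rewrite RintegralD//; last exact: tc_integrable_cos.
rewrite (_ : _ \o row_of = cosfun xi eps + u); last first.
  by apply/funext => x; rewrite /= rowtuple_row.
rewrite LD; [|exact: poly_bounded_cosfun|exact: poly_bounded_peval].
rewrite positive_moment {2}/Rintegral integral_tc_poly/= => h.
apply: (addIr (moment mu 1)); apply: h.
  exact: (continuous_addr (continuous_cosfun_rowtuple xi eps)
    (continuous_peval_rowtuple 1)).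
move=> v; rewrite peval1; have := normr_cosfun xi eps (rowtuple v).
by rewrite ler_norml => /andP[? ?]; apply/andP; split; lra.
Qed.

Let measurable_rowtuple : measurable_fun setT (rowtuple : gT -> n.-tuple R).
Proof.
apply/measurable_fun_tnthP => i.
rewrite (_ : _ \o _ = (fun v : gT => (v : 'rV[R]_n) ord0 i)).
  by apply: continuous_measurable_tc; exact: coord_continuous.
by apply/funext => v /=; rewrite tnth_rowtuple.
Qed.

(** The measure is the image of [tc_measure] under [rowtuple], which moves it from row vectors to
    tuples with their product sigma-algebra. *)
Lemma positive_functional_measure :
  exists nu : {measure set (n.-tuple R) -> \bar R},
    [/\ admissible nu, moment_equiv mu nu &
      forall xi eps, (\int[nu]_x (cos (dotp x xi + eps))%:E)%E = (L (cosfun xi eps))%:E].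
Proof.
have transfer (g : n.-tuple R -> R) : measurable_fun setT g ->
    tc.-integrable setT (fun v : gT => (g (rowtuple v))%:E) ->
    (pushforward tc (rowtuple : gT -> n.-tuple R)).-integrable setT (EFin \o g) /\
    (\int[pushforward tc (rowtuple : gT -> n.-tuple R)]_x (g x)%:E =
     \int[tc]_v (g (rowtuple (v : gT)))%:E)%E.
  move=> mg ig; split.
    by apply: integrable_pushforward => //; exact/measurable_EFinP.
  by rewrite integral_pushforward//; exact/measurable_EFinP.
unshelve eexists (pushforward tc (rowtuple : gT -> n.-tuple R)).
  exact: measurable_rowtuple.
have mpeval p : measurable_fun setT (fun x : n.-tuple R => peval p x).
  by apply/measurable_EFinP; have /integrableP[] := hmu p.
split.
- by move=> p; have [] := transfer (peval p) (mpeval p) (tc_integrable_poly p).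
- move=> p; have [_ ->] := transfer (peval p) (mpeval p) (tc_integrable_poly p).
  by rewrite integral_tc_poly momentE.
- move=> xi eps; have [_ ->] := transfer (cosfun xi eps)
    (measurable_cos_dotp xi eps) (tc_integrable_cos xi eps).
  by rewrite -Rintegral_tc_cos fineK//; apply: integrable_fin_num.
Qed.

End representation.

(** * Indeterminacy from a gap, and the equivalence *)

Lemma gap_moment_equiv_differs {R : realType} {n : nat}
  (mu : {measure set (n.-tuple R) -> \bar R}) (xi : 'rV[R]_n) (eps : R) :
  admissible mu -> (lower_bound_cos mu xi eps < upper_bound_cos mu xi eps)%E ->
  exists nu : {measure set (n.-tuple R) -> \bar R},
    [/\ admissible nu, measure_differs mu nu & moment_equiv mu nu].
Proof.
move=> hmu; rewrite lower_bound_cosE// upper_bound_cosE// lte_fin => gap.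
set l := - upper_moment _ _ in gap; set u := upper_moment _ _ in gap.
pose c0 := (\int[mu]_x cosfun xi eps x)%R.
(* As [l < u], at least one of the two endpoints differs from the integral [c0] of the cosine
   against [mu]. *)
have [c [luc cc0]] : exists c, l <= c <= u /\ c <> c0.
  have [uc0|uc0] := eqVneq u c0.
    by exists l; rewrite lexx ltW//; split => // lc0; move: gap; rewrite lc0 uc0 ltxx.
  by exists u; rewrite lexx ltW//; split => //; exact/eqP.
have [|||L [LS LD LZ Lc]] := sublinear_on_extension (@poly_bounded R n) _ _ _
    (upper_moment mu) (cosfun xi eps) c (sublinear_upper_moment mu hmu)
    (poly_bounded_cosfun xi eps) luc.
- exact: poly_bounded0.
- exact: poly_boundedD.
- exact: poly_boundedZ.
have [nu [hnu mnu cnu]] := positive_functional_measure mu hmu L LS LD LZ.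
exists nu; split => //; apply: contrapT => same.
have munu : forall A, measurable A -> A `<=` setT -> nu A = mu A.
  by move=> A mA _; apply: contrapT => nA; apply: same; exists A.
apply: cc0; rewrite -Lc /c0 /Rintegral -(eq_measure_integral _ munu).
by have /= -> := cnu xi eps.
Qed.

Theorem theorem2p1 (R : realType) (n : nat)
  (mu : {measure set (n.-tuple R) -> \bar R}) (hmu : admissible mu) :
  ((exists nu : {measure set (n.-tuple R) -> \bar R},
      [/\ admissible nu, measure_differs mu nu & moment_equiv mu nu]) <->
   (exists (xi : 'rV[R]_n) (eps : R),
      [/\ xi != 0, (eps = 0 \/ eps = - (pi / 2))
        & (lower_bound_cos mu xi eps < upper_bound_cos mu xi eps)%E])) /\
  (forall eps : R, (eps = 0 \/ eps = - (pi / 2)) ->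
     open [set xi : 'rV[R]_n | xi != 0 /\
             (lower_bound_cos mu xi eps < upper_bound_cos mu xi eps)%E]).
Proof.
split; last by move=> eps _; exact: open_lower_lt_upper_cos.
split=> [[nu [hnu munu e]]|[xi [eps [_ _ gap]]]].
  exact: moment_equiv_differs_gap munu.
exact: gap_moment_equiv_differs gap.
Qed.
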